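(* Let $k\ge 1$ and $v\ge 2$ be integers. The unimodular equivalence classes of Gorenstein simplices (of any dimension) which are not lattice pyramids and whose $h^*$-polynomial is $$1+t^k+t^{2k}+\cdots+t^{(v-1)k}$$ are in bijection with the following data: (i) a strict divisor chain $1=M_0<M_1<\cdots<M_s=v$; (ii) for each $i=1,\ldots,s$, a subset $J_i\subseteq \mathcal{L}_{i-1}$, where the finite sets $\mathcal{L}_i$ are defined recursively by $\mathcal{L}_0=\emptyset$ and $\mathcal{L}_i=(\mathcal{L}_{i-1}\setminus J_i)\cup\{\ell_i\}$, and $\ell_i$ is a (new) formal symbol created at the $i$-th step.
   Context: A lattice polytope is a convex polytope all of whose vertices have integer coordinates; a lattice simplex is a lattice polytope that is a simplex. A $d$-dimensional lattice simplex is considered in $\mathbb{R}^d$. Two lattice polytopes $\mathcal{P},\mathcal{Q}\subset\mathbb{R}^d$ are unimodularly equivalent if there are a unimodular matrix $U\in\mathbb{Z}^{d\times d}$ and $\mathbf{w}\in\mathbb{Z}^d$ with $\mathcal{Q}=\{\mathbf{x}U+\mathbf{w}:\mathbf{x}\in\mathcal{P}\}$. For a $d$-dimensional lattice polytope $\mathcal{P}\subset\mathbb{R}^d$, put $L_{\mathcal{P}}(m)=|m\mathcal{P}\cap\mathbb{Z}^d|$ for $m\ge1$. The $h^*$-polynomial $h^*(\mathcal{P},t)$ is the polynomial (of degree at most $d$) defined by $1+\sum_{m\ge1}L_{\mathcal{P}}(m)t^m=h^*(\mathcal{P},t)/(1-t)^{d+1}$. The lattice pyramid over $\mathcal{P}\subset\mathbb{R}^d$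 is $\mathrm{Pyr}(\mathcal{P})=\mathrm{conv}(\mathcal{P}\times\{0\},(0,\ldots,0,1))\subset\mathbb{R}^{d+1}$. A lattice polytope is called a lattice pyramid if it is (up to unimodular equivalence) obtained by successively taking lattice pyramids (at least once) over a lower-dimensional lattice polytope. A lattice polytope $\mathcal{P}\subset\mathbb{R}^d$ is reflexive if the origin is in its interior and its dual polytope is again a lattice polytope. $\mathcal{P}$ is Gorenstein if, for some positive integer $r$, $r\mathcal{P}$ is unimodularly equivalent to a reflexive polytope. A strict divisor chain $1=M_0<M_1<\cdots<M_s=v$ is a strictly increasing chain in the divisor lattice $D_v$ of $v$ (the positive divisors of $v$ ordered by divisibility), i.e. $M_{i-1}\mid M_i$ and $M_{i-1}\ne M_i$ for all $i$; the length $s\ge 1$ is part of the data. *)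

(* Defs.v *)
From HB Require Import structures.
From mathcomp Require Import all_boot all_order all_algebra finmap.
From mathcomp Require Import all_classical all_reals all_analysis.

Set Implicit Arguments.
Unset Strict Implicit.
Unset Printing Implicit Defensive.

Import Order.TTheory GRing.Theory Num.Theory. 
Import numFieldNormedType.Exports.
Local Open Scope classical_set_scope.
Local Open Scope ring_scope.

Section Polytopes.
Variable R : realType.

Definition intvec d (w : 'rV[int]_d) : 'rV[R]_d := map_mx intr w.

Definition Zlattice d : set 'rV[R]_d := range (@intvec d).

Definition conv_hull d (A : set 'rV[R]_d) : set 'rV[R]_d :=
  smallest (@convex_set R 'rV[R]_d) A.

Definition polytope d (P : set 'rV[R]_d) : Prop :=
  exists A : set 'rV[R]_d, finite_set A /\ P = conv_hull A.

(* The vertices of a polytope are its extreme points. *)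
Definition vertices d (P : set 'rV[R]_d) : set 'rV[R]_d :=
  [set x | P x /\ forall (y z : 'rV[R]_d) (t : R), P y -> P z ->
     0 < t < 1 -> x = t *: y + (1 - t) *: z -> y = x /\ z = x].

Definition lattice_polytope d (P : set 'rV[R]_d) : Prop :=
  polytope P /\ vertices P `<=` @Zlattice d.

Definition affinely_independent d n (V : 'I_n -> 'rV[R]_d) : Prop :=
  forall a : 'I_n -> R, \sum_i a i = 0 -> \sum_i a i *: V i = 0 ->
  forall i, a i = 0.

(* Simplices are full-dimensional: a simplex in R^d has d + 1 vertices. *)
Definition simplex d (P : set 'rV[R]_d) : Prop :=
  exists V : 'I_d.+1 -> 'rV[R]_d,
    affinely_independent V /\ P = conv_hull (range V).

Definition lattice_simplex d (P : set 'rV[R]_d) : Prop :=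
  lattice_polytope P /\ simplex P.

(* [U \in unitmx] over [int] says that the determinant of U is 1 or -1. *)
Definition unimod_equiv d (P Q : set 'rV[R]_d) : Prop :=
  exists (U : 'M[int]_d) (w : 'rV[int]_d), U \in unitmx /\
    Q = [set x *m map_mx intr U + intvec w | x in P].

Definition dilate d (m : nat) (P : set 'rV[R]_d) : set 'rV[R]_d :=
  [set m%:R *: x | x in P].

Definition ehrhart d (P : set 'rV[R]_d) (m : nat) : nat :=
  #|` fset_set (dilate m P `&` @Zlattice d)|.

(* Coefficients of the series 1 + \sum_(m >= 1) L_P(m) t^m. *)
Definition ehrhart_series d (P : set 'rV[R]_d) (m : nat) : int :=
  if m == 0%N then 1 else (ehrhart P m)%:Z.

(* "h is the h^*-polynomial of P": the defining identity, multiplied by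
   (1 - t)^(d+1), is read coefficient by coefficient (a Cauchy product). *)
Definition is_hstar d (P : set 'rV[R]_d) (h : {poly int}) : Prop :=
  (size h <= d.+1)%N /\
  forall n : nat, h`_n =
    \sum_(i < n.+1) ((1 - 'X) ^+ d.+1 : {poly int})`_i *
                    ehrhart_series P (n - i)%N.

Definition dual_polytope d (P : set 'rV[R]_d) : set 'rV[R]_d :=
  [set y | forall x, P x -> \sum_i x 0 i * y 0 i <= 1].

Definition reflexive_polytope d (P : set 'rV[R]_d) : Prop :=
  [/\ lattice_polytope P, P^° 0 & lattice_polytope (dual_polytope P)].

Definition gorenstein d (P : set 'rV[R]_d) : Prop :=
  exists (r : nat) (Q : set 'rV[R]_d),
    [/\ (0 < r)%N, reflexive_polytope Q & unimod_equiv (dilate r P) Q].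

(* The point (x, h) of R^(d+1), for x in R^d. *)
Definition append_coord d (x : 'rV[R]_d) (h : R) : 'rV[R]_d.+1 :=
  \row_i (if unlift ord_max i is Some j then x 0 j else h).

Definition pyr d (P : set 'rV[R]_d) : set 'rV[R]_d.+1 :=
  conv_hull ([set append_coord x 0 | x in P] `|` [set append_coord 0 1]).

(* A subset of some R^d, packaged with its ambient dimension d. *)
Definition body : Type := {d : nat & set 'rV[R]_d}.

Definition Body d (P : set 'rV[R]_d) : body := existT _ d P.

Definition Pyr (B : body) : body := Body (pyr (projT2 B)).

(* Bodies of different ambient dimensions are never equivalent. *)
Definition body_equiv (B C : body) : Prop :=
  exists (d : nat) (P Q : set 'rV[R]_d),
    [/\ B = Body P, C = Body Q & unimod_equiv P Q].

Definition lattice_pyramid (B : body) : Prop :=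
  exists (n e : nat) (Q : set 'rV[R]_e),
    lattice_polytope Q /\ body_equiv (iter n.+1 Pyr (Body Q)) B.

Definition unimod_class (B : body) : set body := [set C | body_equiv B C].

Definition nonpyramidal_gorenstein_simplices (h : {poly int}) : set body :=
  [set B | [/\ lattice_simplex (projT2 B), gorenstein (projT2 B),
               ~ lattice_pyramid B & is_hstar (projT2 B) h]].

End Polytopes.

Arguments nonpyramidal_gorenstein_simplices R h : clear implicits.

(* M lists M_0, ..., M_s. *)
Definition strict_divisor_chain (v : nat) (M : seq nat) : Prop :=
  [/\ (1 < size M)%N, head 0%N M = 1%N, last 0%N M = v &
      sorted (fun a b : nat => (a %| b)%N && (a != b)) M].

(* J lists J_1, ..., J_s, so that J_i is the item of index i - 1; the symbol
   created at the i-th step is represented by the number i. [symbols J i] is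
   the set L_i. *)
Fixpoint symbols (J : seq {fset nat}) (i : nat) : {fset nat} :=
  if i is j.+1 then (i |` (symbols J j `\` nth fset0 J j))%fset else fset0.

Definition chain_data (v : nat) : set (seq nat * seq {fset nat}) :=
  [set D | [/\ strict_divisor_chain v D.1, size D.1 = (size D.2).+1 &
     forall i : nat, (i < size D.2)%N ->
       (nth fset0 D.2 i `<=` symbols D.2 i)%fset]].

(* Main.v *)
Require Import Defs.
From mathcomp Require Import all_boot all_order all_algebra all_fingroup finmap.
From mathcomp Require Import all_classical all_reals all_analysis.
From mathcomp Require Import lra ring zify.

(** A simplex with vertices V_0, ..., V_d has a group: the real vectors c for
which sum c_i (1, V_i) is integral. It contains Z^(d+1), with finite quotient,
and three facts reduce the theorem to a statement about such groups Lam. The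
coefficient of t^j in the h^*-polynomial is the number of elements of Lam in the
box [0, 1)^(d+1) with coordinate sum, or height, equal to j [hstar_coef]. Two
simplices are equivalent exactly when their groups agree up to a permutation of
the coordinates [hull_inj, Lam_perm, Lam_eq_unimod]. A simplex is a lattice
pyramid exactly when some coordinate is integral on the whole group
[pyramid_int_coord, int_coord_pyramid]. So the groups to classify, up to
permutation, are those with one class of each height 0, k, ..., (v - 1) k and no
integral coordinate.

Such a group has a canonical filtration. The height is subadditive, and additive
only when no coordinate overflows. Suppose that the classes of height below M k
form a subgroup H, let g be the class of height M k, and m its order modulo H.
Since no two classes share a height, counting forces h + t g to have height
(height of h) + t M k for all h in H and t < m [level_shift]. Hence the classes of
height below m M k again form a subgroup, and iterating produces the divisor
chain. Moreover h + t g never overflows, which is so restrictive that m g must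
be the sum of some of the generators not yet absorbed, plus the indicator of
a set of fresh coordinates [mx_roots]; the absorbed generators are the set J of
the step, and the generators available are the symbols [heights_realizes].

Conversely the relations m_a g_a = (sum over J_a of g_b) + (fresh coordinates)
determine g_1, ..., g_s once the sizes of the blocks of fresh coordinates are
known, and prescribing the height M_(a-1) k of g_a fixes these sizes
[realizes_same]. The elements of the box are then the combinations of the g_a
with digits c_a < m_a, of height k times the sum of the c_a M_(a-1); by mixed
radix these heights are 0, k, ..., (v - 1) k, each once [span_heights]. The
data is recovered from the group [realizes_unique], since g_a is the element of
height M_(a-1) k. Finally every choice of data comes from a simplex, with one
vertex for each coordinate [simplex_of_basis], and this simplex is Gorenstein
because the sum of the unabsorbed generators is the least positive element of
the group [gorenstein_of_min]. *)

Set Implicit Arguments.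
Unset Strict Implicit.
Unset Printing Implicit Defensive.

Import Order.TTheory GRing.Theory Num.Theory.
Import numFieldNormedType.Exports.
Local Open Scope classical_set_scope.
Local Open Scope ring_scope.

(** * Mixed radix and generators *)

Definition step_ratio (M : seq nat) (a : nat) : nat := (nth 0%N M a.+1 %/ nth 0%N M a)%N.

(** The chain data without its top v, so that it can be grown one step at a
time. *)
Definition filtration_data (M : seq nat) (J : seq {fset nat}) : Prop :=
  [/\ size M = (size J).+1, nth 0%N M 0 = 1%N,
      forall a, (a < size J)%N ->
        (nth 0%N M a %| nth 0%N M a.+1)%N && (nth 0%N M a < nth 0%N M a.+1)%N
    & forall a, (a < size J)%N -> (nth fset0 J a `<=` symbols J a)%fset].

Definition digits (M : seq nat) (j : nat) (c : nat -> nat) : Prop :=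
  forall b, (b < j)%N -> (c b < step_ratio M b)%N.

Section ChainLike.
Context {M : seq nat} {J : seq {fset nat}}.
Hypothesis MJ : filtration_data M J.

Lemma chain_dvd a : (a < size J)%N -> (nth 0%N M a %| nth 0%N M a.+1)%N.
Proof. by case: MJ => _ _ + _ => /[apply] /andP[]. Qed.

Lemma chain_step a :
  (a < size J)%N -> nth 0%N M a.+1 = (step_ratio M a * nth 0%N M a)%N.
Proof. by move=> aJ; rewrite divnK// chain_dvd. Qed.

Lemma chain_lt a : (a < size J)%N -> (nth 0%N M a < nth 0%N M a.+1)%N.
Proof. by case: MJ => _ _ + _ => /[apply] /andP[]. Qed.

Lemma chain_gt0 a : (a <= size J)%N -> (0 < nth 0%N M a)%N.
Proof.
elim: a => [_|a IH aJ]; first by case: MJ => _ ->.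
exact: leq_ltn_trans (leq0n _) (chain_lt aJ).
Qed.

Lemma ratio_ge2 a : (a < size J)%N -> (2 <= step_ratio M a)%N.
Proof.
move=> aJ; have := chain_lt aJ; rewrite chain_step//.
by case: (step_ratio M a) => [|[|//]]; rewrite ?mul0n ?mul1n ?ltnn.
Qed.

Lemma mem_symbols a b : b \in symbols J a -> (0 < b <= a)%N.
Proof.
elim: a b => [|a IH] b /=; first by rewrite inE.
rewrite !inE => /orP[/eqP ->|/andP[_ /IH]]; first by rewrite ltn0Sn leqnn.
by move=> /andP[-> /leq_trans]; apply.
Qed.

Lemma symbolsS a b : (b.+1 \in symbols J a.+1) =
  (b == a) || (b.+1 \in symbols J a) && (b.+1 \notin nth fset0 J a).
Proof. by rewrite /= !inE eqSS [X in _ || X]andbC. Qed.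

(** Since M_j is the product of the first j ratios, bounded digits are a mixed
radix expansion of the numbers below M_j. *)
Lemma digits_lt j (c : nat -> nat) : (j <= size J)%N -> digits M j c ->
  (\sum_(b < j) c b * nth 0%N M b < nth 0%N M j)%N.
Proof.
elim: j => [_ _|j IH jJ dc]; first by rewrite big_ord0; case: MJ => _ ->.
rewrite big_ord_recr/= chain_step//.
have /IH : digits M j c by move=> b bj; apply: dc; lia.
move=> /(_ (ltnW jJ)) lt; have cj := dc j (ltnSn j).
apply: leq_trans (_ : (c j).+1 * nth 0%N M j <= _)%N; last first.
  by rewrite leq_mul2r cj orbT.
by rewrite mulSnr addnC ltn_add2l.
Qed.

Lemma digits_inj j (c c' : nat -> nat) : (j <= size J)%N ->
  digits M j c -> digits M j c' ->
  (\sum_(b < j) c b * nth 0%N M b = \sum_(b < j) c' b * nth 0%N M b)%N ->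
  forall b, (b < j)%N -> c b = c' b.
Proof.
elim: j => [//|j IH jJ dc dc'].
rewrite !big_ord_recr/= => E.
have D : digits M j c by move=> b bj; apply: dc; lia.
have D' : digits M j c' by move=> b bj; apply: dc'; lia.
have lt := @digits_lt j c (ltnW jJ) D; have lt' := @digits_lt j c' (ltnW jJ) D'.
have cc : c j = c' j.
  have := congr1 (divn^~ (nth 0%N M j)) E => /=.
  rewrite !divnDMl ?(leq_ltn_trans _ lt)//.
  by rewrite !divn_small.
move: E; rewrite cc => /addIn E b; rewrite ltnS leq_eqVlt => /orP[/eqP->//|].
by apply: IH => //; lia.
Qed.

Lemma digits_surj j x : (j <= size J)%N -> (x < nth 0%N M j)%N ->
  exists c, digits M j c /\ (\sum_(b < j) c b * nth 0%N M b = x)%N.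
Proof.
elim: j x => [|j IH] x jJ.
  case: MJ => _ -> _ _; rewrite ltnS leqn0 => /eqP ->.
  by exists (fun _ => 0%N); split => //; rewrite big_ord0.
have M0 : (0 < nth 0%N M j)%N by exact: chain_gt0 (ltnW jJ).
rewrite chain_step// => xlt.
have [c [dc cE]] := IH (x %% nth 0%N M j)%N (ltnW jJ) (ltn_pmod _ M0).
exists (fun b => if b == j then (x %/ nth 0%N M j)%N else c b); split.
  move=> b; rewrite ltnS leq_eqVlt; case: eqP => [-> _|_ /= /dc//].
  by rewrite ltn_divLR.
rewrite big_ord_recr/= eqxx [RHS](divn_eq x (nth 0%N M j)) addnC; congr addn.
by rewrite -cE; apply: eq_bigr => b _; rewrite ltn_eqF.
Qed.

End ChainLike.

Section Generators.
Variable R : realType.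

Definition born n (birth : 'I_n -> nat) (a : nat) : 'rV[R]_n :=
  \row_i (birth i == a)%:R.

(** The symbols available after step a are the roots of the forest of
absorptions. Their generators have disjoint supports, so a coordinate of this
sum is the value there of the only root that contains it. *)
Definition root_sum n (J : seq {fset nat}) (g : nat -> 'rV[R]_n) (a : nat) :
  'rV[R]_n := \sum_(b < a | b.+1 \in symbols J a) g b.+1.

(** Generator a.+1 is an (M_(a+1)/M_a)-th part of the sum of the generators
absorbed at its step, extended by fresh coordinates, whose birth is a.+1. Births beyond the
last step mark the coordinates that no generator has reached. *)
Definition generators n (M : seq nat) (J : seq {fset nat})
    (birth : 'I_n -> nat) (g : nat -> 'rV[R]_n) : Prop :=
  (forall i, (0 < birth i)%N) /\
  forall a, (a < size J)%N -> (step_ratio M a)%:R *: g a.+1 =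
    \sum_(b < a | b.+1 \in nth fset0 J a) g b.+1 + born birth a.+1.

Definition in_span n (s : nat) (g : nat -> 'rV[R]_n) (c : 'rV[R]_n) : Prop :=
  exists t : nat -> int,
    forall i, c 0 i - \sum_(b < s) (t b)%:~R * g b.+1 0 i \is a Num.int.

Definition int_row n (c : 'rV[R]_n) : Prop := forall i, c 0 i \is a Num.int.

Lemma eq_int (x y : R) : x \is a Num.int -> x = y -> y \is a Num.int.
Proof. by move=> + <-. Qed.

Lemma span_sub n s (g : nat -> 'rV[R]_n) c c' :
  in_span s g c -> in_span s g c' -> in_span s g (c - c').
Proof.
move=> [t tE] [t' tE']; exists (fun b => t b - t' b) => i.
have -> : \sum_(b < s) (t b - t' b)%:~R * g b.+1 0 i =
    \sum_(b < s) (t b)%:~R * g b.+1 0 i - \sum_(b < s) (t' b)%:~R * g b.+1 0 i.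
  by rewrite -sumrB; apply: eq_bigr => b _; rewrite intrB mulrBl.
by have := rpredB (tE i) (tE' i); rewrite !mxE => /eq_int; apply; ring.
Qed.

Lemma span0 n s (g : nat -> 'rV[R]_n) : in_span s g 0.
Proof.
by exists (fun=> 0) => i; rewrite mxE big1 ?subr0// => b _; rewrite mul0r.
Qed.

Lemma span_add n s (g : nat -> 'rV[R]_n) c c' :
  in_span s g c -> in_span s g c' -> in_span s g (c + c').
Proof.
by move=> h h'; have := span_sub h (span_sub (span0 s g) h'); rewrite sub0r opprK.
Qed.

Lemma span_scale n s (g : nat -> 'rV[R]_n) c x : x \is a Num.int ->
  in_span s g c -> in_span s g (x *: c).
Proof.
move=> /intrP[z ->] [t tE]; exists (fun b => z * t b) => i.
have := rpredM (intr_int R z) (tE i); rewrite mxE mulrBr mulr_sumr => /eq_int; apply.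
by congr (_ - _); apply: eq_bigr => b _; rewrite intrM mulrA.
Qed.

Lemma span_int n s (g : nat -> 'rV[R]_n) c : int_row c -> in_span s g c.
Proof.
by move=> ci; exists (fun=> 0) => i; rewrite big1 ?subr0// => b _; rewrite mul0r.
Qed.

Lemma span_gen n s (g : nat -> 'rV[R]_n) a : (a < s)%N -> in_span s g (g a.+1).
Proof.
move=> aJ; exists (fun b => (b == a)%:Z) => i.
rewrite (bigD1 (Ordinal aJ))//= eqxx mul1r big1 ?addr0 ?subrr//.
by move=> b; rewrite -val_eqE/= => /negPf ->; rewrite mul0r.
Qed.

Section Facts.
Context {n : nat} {M : seq nat} {J : seq {fset nat}} {birth : 'I_n -> nat}.
Context {g : nat -> 'rV[R]_n}.
Hypothesis MJ : filtration_data M J.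
Hypothesis G : generators M J birth g.

Lemma genE a i : (a < size J)%N -> (step_ratio M a)%:R * g a.+1 0 i =
  \sum_(b < a | b.+1 \in nth fset0 J a) g b.+1 0 i + (birth i == a.+1)%:R.
Proof.
move=> aJ; have [_ /(_ a aJ)/rowP/(_ i)] := G.
by rewrite !mxE summxE.
Qed.

Lemma ratioR_gt0 a : (a < size J)%N -> 0 < (step_ratio M a)%:R :> R.
Proof. by move=> /(ratio_ge2 MJ) h; rewrite ltr0n; lia. Qed.

Lemma gen_ge0 a i : (a < size J)%N -> 0 <= g a.+1 0 i.
Proof.
elim/ltn_ind: a => a IH aJ.
rewrite -(pmulr_rge0 _ (ratioR_gt0 aJ)) genE// addr_ge0//.
apply: sumr_ge0 => b _; apply: IH => //; exact: ltn_trans aJ.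
Qed.

Lemma gen_unborn a i : (a < size J)%N -> (a.+1 < birth i)%N -> g a.+1 0 i = 0.
Proof.
elim/ltn_ind: a => a IH aJ ai.
apply: (mulfI (lt0r_neq0 (ratioR_gt0 aJ))).
rewrite mulr0 genE// [birth i == _]gtn_eqF// addr0 big1// => b _.
by apply: IH => //; [exact: ltn_trans aJ|apply: leq_ltn_trans ai; rewrite ltnS ltnW].
Qed.

Lemma gen_birth a i : (a < size J)%N -> birth i = a.+1 ->
  (step_ratio M a)%:R * g a.+1 0 i = 1.
Proof.
move=> aJ ia; rewrite genE// ia eqxx big1 ?add0r// => b _.
by rewrite gen_unborn// ?ia ?ltnS//; exact: ltn_trans aJ.
Qed.

Lemma gen_birth_gt0 a i : (a < size J)%N -> birth i = a.+1 -> 0 < g a.+1 0 i.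
Proof.
by move=> aJ /(gen_birth aJ) E; rewrite -(pmulr_rgt0 _ (ratioR_gt0 aJ)) E.
Qed.

Lemma root_sumE a i :
  root_sum J g a 0 i = \sum_(b < a | b.+1 \in symbols J a) g b.+1 0 i.
Proof. by rewrite summxE. Qed.

(** With r the ratio, the absorbed roots and the fresh coordinates together are
r times the new root; replacing them loses r - 1 times the new root. *)
Lemma root_sumS a i : (a < size J)%N ->
  root_sum J g a.+1 0 i =
  root_sum J g a 0 i + (birth i == a.+1)%:R - ((step_ratio M a)%:R - 1) * g a.+1 0 i.
Proof.
move=> aJ; rewrite !root_sumE.
rewrite big_mkcond big_ord_recr -big_mkcond symbolsS eqxx/=.
rewrite mulrBl genE// mul1r.
rewrite [X in _ = X + _ - _](bigID (fun b : 'I_a => b.+1 \in nth fset0 J a))/=.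
rewrite (eq_bigl (fun b : 'I_a => (b.+1 \in symbols J a) &&
  (b.+1 \notin nth fset0 J a))); last first.
  by move=> b; rewrite [LHS]symbolsS ltn_eqF.
rewrite [X in _ = X + _ + _ - _](eq_bigl
  (fun b : 'I_a => b.+1 \in nth fset0 J a)); first ring.
move=> b; case: MJ => _ _ _ /(_ a aJ)/fsubsetP/(_ b.+1).
by case: (b.+1 \in nth _ _ _); rewrite ?andbF// => ->.
Qed.

Lemma root_sum_ge0 a i : (a <= size J)%N -> 0 <= root_sum J g a 0 i.
Proof.
move=> aJ; rewrite root_sumE sumr_ge0// => b _; apply: gen_ge0.
exact: leq_trans aJ.
Qed.

Lemma root_sum_unborn a i : (a <= size J)%N -> (a < birth i)%N ->
  root_sum J g a 0 i = 0.
Proof.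
move=> aJ ai; rewrite root_sumE big1// => b _; apply: gen_unborn.
  exact: leq_trans aJ.
exact: leq_ltn_trans ai.
Qed.

(** A generator that has been absorbed survives in a root as a proper part, and
the ratio is at least 2: this is where the factor 2 comes from. *)
Lemma root_sum_le a b i : (b < a)%N -> (a <= size J)%N -> birth i = b.+1 ->
  0 < root_sum J g a 0 i /\
  if b.+1 \in symbols J a then root_sum J g a 0 i <= g b.+1 0 i
  else 2 * root_sum J g a 0 i <= g b.+1 0 i.
Proof.
elim: a => [//|a IH]; rewrite ltnS leq_eqVlt => /orP[/eqP <- bJ ib|ba aJ ib].
  have B := gen_birth bJ ib; have P := gen_birth_gt0 bJ ib.
  rewrite symbolsS eqxx/= root_sumS// ib eqxx root_sum_unborn ?ib ?(ltnW bJ)//.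
  by rewrite mulrBl B /=; split; lra.
have [U0 Ule] := IH ba (ltnW aJ) ib.
have r2 : 2 <= (step_ratio M a)%:R :> R by rewrite ler_nat (ratio_ge2 MJ).
have g0 := gen_ge0 i aJ.
have gE := genE i aJ; have uS := root_sumS i aJ.
move: gE uS; rewrite ib eqSS ltn_eqF// !addr0.
set r := (step_ratio M a)%:R in r2 *; set x := g a.+1 0 i in g0 *.
set S := \sum_(_ < _ | _) _; set u := root_sum J g a.+1 0 i.
set U := root_sum J g a 0 i in U0 Ule * => rxE uE.
have SU : S <= U.
  rewrite /U root_sumE /S big_mkcond [leRHS]big_mkcond/=; apply: ler_sum => l _.
  have lJ := ltn_trans (ltn_ord l) aJ.
  case: MJ => _ _ _ /(_ a aJ)/fsubsetP/(_ l.+1).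
  case: ifP => [_ -> //|_ _]; case: ifP => // _; exact: gen_ge0.
have x0U : x <= r * x by rewrite ler_peMl//; lra.
have rxU : 2 * x <= r * x by rewrite ler_wpM2r.
have uU : u <= U by rewrite uE mulrBl; lra.
have u0 : 0 < u.
  rewrite uE mulrBl; have [x0|x0] := ltP 0 x; first lra.
  have -> : x = 0 by apply/eqP; rewrite eq_le x0 g0.
  by rewrite !mulr0; lra.
split => //; rewrite symbolsS ltn_eqF//=.
case: ifPn Ule => bs Ule; last by rewrite /=; lra.
case: ifPn => bJa; first lra.
(* When b is absorbed now, it is the only root alive at i, so that S, U and the
   value of g b agree there, and both u and x are their part of index r. *)
have gS : g b.+1 0 i <= S.
  rewrite /S (bigD1 (Ordinal ba)) ?(negbNE bJa)//= lerDl sumr_ge0// => l _.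
  by apply: gen_ge0; exact: ltn_trans aJ.
rewrite mulrBl in uE; lra.
Qed.

End Facts.
End Generators.

(** * Heights of the generated group *)

Section Heights.
Variable R : realType.

Definition unit_box n (c : 'rV[R]_n) : Prop := forall i, 0 <= c 0 i < 1.

Definition heights (k v : nat) n (Lam : 'rV[R]_n -> Prop) : Prop :=
  [/\ forall c, Lam c -> unit_box c ->
        exists a, (a < v)%N /\ \sum_i c 0 i = (a * k)%:R,
      forall a, (a < v)%N ->
        exists c, [/\ Lam c, unit_box c & \sum_i c 0 i = (a * k)%:R]
    & forall c c', Lam c -> unit_box c -> Lam c' -> unit_box c' ->
        \sum_i c 0 i = \sum_i c' 0 i -> c = c'].

Definition gen_heights (k : nat) (M : seq nat) (J : seq {fset nat}) n
    (g : nat -> 'rV[R]_n) : Prop :=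
  forall a, (a < size J)%N -> \sum_i g a.+1 0 i = (nth 0%N M a * k)%:R.

Definition realizes k M J n (Lam : 'rV[R]_n -> Prop) : Prop :=
  exists birth g,
    [/\ generators M J birth g, forall i, (birth i <= size J)%N,
        gen_heights k M J g & forall c, Lam c <-> in_span (size J) g c].

Section Facts.
Context {n : nat} {M : seq nat} {J : seq {fset nat}} {birth : 'I_n -> nat}.
Context {g : nat -> 'rV[R]_n}.
Hypothesis MJ : filtration_data M J.
Hypothesis G : generators M J birth g.

(** Summing the relations of the generators telescopes, every generator other
than a root being absorbed once: even the largest digits leave the room of the
root sum below 1. *)
Lemma top_digits a i : (a <= size J)%N ->
  \sum_(b < a) ((step_ratio M b)%:R - 1) * g b.+1 0 i =
  (birth i <= a)%:R - root_sum J g a 0 i.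
Proof.
elim: a => [_|a IH aJ].
  rewrite big_ord0 root_sumE big_ord0 leqNgt; case: G => -> _.
  by rewrite subr0.
rewrite big_ord_recr/= (IH (ltnW aJ)) (root_sumS MJ G i aJ) [(_ <= a.+1)%N]leq_eqVlt ltnS.
case: (eqVneq (birth i) a.+1) => [->|_]/=; last by rewrite addr0; ring.
by rewrite ltnn /=; ring.
Qed.

Definition digit_sum (a : nat) (c : nat -> nat) : 'rV[R]_n :=
  \sum_(b < a) (c b)%:R *: g b.+1.

Lemma digit_sumE a c i :
  digit_sum a c 0 i = \sum_(b < a) (c b)%:R * g b.+1 0 i.
Proof. by rewrite summxE; apply: eq_bigr => b _; rewrite mxE. Qed.

Lemma digit_sum_ge0 a c i : (a <= size J)%N -> 0 <= digit_sum a c 0 i.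
Proof.
move=> aJ; rewrite digit_sumE sumr_ge0// => b _; rewrite mulr_ge0//.
apply: (gen_ge0 MJ G); exact: leq_trans aJ.
Qed.

Lemma digit_sum_le a c i : (a <= size J)%N -> digits M a c ->
  digit_sum a c 0 i <= (birth i <= a)%:R - root_sum J g a 0 i.
Proof.
move=> aJ dc; rewrite -top_digits// digit_sumE ler_sum// => b _.
have bJ := leq_trans (ltn_ord b) aJ.
rewrite ler_wpM2r ?(gen_ge0 MJ G)// lerBrDr natr1 ler_nat.
exact: dc.
Qed.

Lemma digit_sum_box a c : (a <= size J)%N -> digits M a c ->
  unit_box (digit_sum a c).
Proof.
move=> aJ dc i; rewrite digit_sum_ge0//=.
apply: le_lt_trans (digit_sum_le i aJ dc) _.
case: (leqP (birth i) a) => ia /=; last first.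
  by have := root_sum_ge0 MJ G i aJ; lra.
have i0 : (0 < birth i)%N by case: G.
have ib : birth i = (birth i).-1.+1 by rewrite prednK.
have ba : ((birth i).-1 < a)%N by rewrite -ib.
by have [u0 _] := root_sum_le MJ G ba aJ ib; lra.
Qed.

Lemma digit_sum_height k a c : gen_heights k M J g -> (a <= size J)%N ->
  \sum_i digit_sum a c 0 i = ((\sum_(b < a) c b * nth 0%N M b) * k)%:R.
Proof.
move=> Hk aJ; under eq_bigr do rewrite digit_sumE.
rewrite exchange_big/= big_distrl/= natr_sum; apply: eq_bigr => b _.
by rewrite -mulr_sumr Hk ?(leq_trans (ltn_ord b))// -natrM mulnA.
Qed.

(** Multiples of a generator carry into the generators it absorbed. *)
Lemma span_digits a (t : nat -> int) : (a <= size J)%N ->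
  exists c, digits M a c /\ forall i,
    \sum_(b < a) (t b)%:~R * g b.+1 0 i - digit_sum a c 0 i \is a Num.int.
Proof.
elim: a t => [|a IH] t aJ.
  by exists (fun=> 0%N); split=> // i; rewrite digit_sumE !big_ord0 subr0.
pose r := step_ratio M a; have r2 : (2 <= r)%N := ratio_ge2 MJ aJ.
pose q := (t a %/ r)%Z; pose m := `|(t a %% r)%Z|%N.
have tE : t a = q * r + m.
  by rewrite {1}(divz_eq (t a) r) /m gez0_abs// modz_ge0//; lia.
have mr : (m < r)%N.
  have : (t a %% r < r)%Z by rewrite ltz_pmod//; lia.
  have : (0 <= t a %% r)%Z by rewrite modz_ge0//; lia.
  by rewrite /m; lia.
have [c [dc cE]] := IH (fun b => t b + q * (b.+1 \in nth fset0 J a)%:Z) (ltnW aJ).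
exists (fun b => if b == a then m else c b); split.
  by move=> b; rewrite ltnS leq_eqVlt; case: eqP => [->//|_ /= /dc].
move=> i; rewrite digit_sumE !big_ord_recr/= eqxx.
have -> : \sum_(b < a) (if b == a :> nat then m else c b)%:R * g b.+1 0 i =
    digit_sum a c 0 i.
  by rewrite digit_sumE; apply: eq_bigr => b _; rewrite ltn_eqF.
have -> : (t a)%:~R = q%:~R * (step_ratio M a)%:R + m%:R :> R.
  by rewrite tE intrD intrM !pmulrn.
have /= := cE i; under eq_bigr do rewrite intrD intrM mulrDl.
rewrite big_split/=.
have -> : \sum_(b < a) q%:~R * ((b.+1 \in nth fset0 J a)%:Z)%:~R * g b.+1 0 i =
    q%:~R * ((step_ratio M a)%:R * g a.+1 0 i - (birth i == a.+1)%:R).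
  rewrite (genE G)// addrK mulr_sumr [RHS]big_mkcond; apply: eq_bigr => b _.
  by case: ifP => _; rewrite ?mulr1 ?mulr0 ?mul0r.
set X := \sum_(_ < a) _; set Y := digit_sum _ _ _ _ => Z.
rewrite (_ : _ - _ = X +
    q%:~R * ((step_ratio M a)%:R * g a.+1 0 i - (birth i == a.+1)%:R) - Y +
    q%:~R * (birth i == a.+1)%:R); last ring.
by rewrite rpredD// rpredM ?intr_int// natr_int.
Qed.

Lemma int_lt1 (x y : R) : x - y \is a Num.int -> 0 <= x < 1 -> 0 <= y < 1 -> x = y.
Proof.
move=> /intrP[z zE] xb yb.
have z1 : (z%:~R < 1%:~R :> R) by rewrite -zE; lra.
have z2 : ((-1)%:~R < z%:~R :> R) by rewrite -zE rmorphN/=; lra.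
rewrite !ltr_int in z1 z2.
have z0 : z = 0 by lia.
by apply/eqP; rewrite -subr_eq0 zE z0.
Qed.

Lemma span_box a c : (a <= size J)%N -> in_span a g c -> unit_box c ->
  exists2 e, digits M a e & c = digit_sum a e.
Proof.
move=> aJ [t tE] cb; have [e [de eE]] := span_digits t aJ.
exists e => //; apply/rowP => i; apply: int_lt1 => //; last exact: digit_sum_box.
by have := rpredD (tE i) (eE i); rewrite addrA subrK.
Qed.

Lemma digit_sum_span a e : in_span a g (digit_sum a e).
Proof.
by exists (fun b => e b : int) => i; rewrite digit_sumE subrr.
Qed.

Lemma span_heights k : (0 < k)%N -> gen_heights k M J g ->
  heights k (nth 0%N M (size J)) (in_span (size J) g).
Proof.
move=> k0 Hk; split=> [c cs cb|a av|c c' cs cb cs' cb'].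
- have [e de ->] := span_box (leqnn _) cs cb.
  exists (\sum_(b < size J) e b * nth 0%N M b)%N; split; last first.
    exact: (digit_sum_height _ Hk).
  exact: (digits_lt MJ (leqnn _) de).
- have [e [de eE]] := digits_surj MJ (leqnn _) av.
  exists (digit_sum (size J) e); split; first exact: digit_sum_span.
    exact: digit_sum_box.
  by rewrite (digit_sum_height _ Hk)// eE.
- have [e de ->] := span_box (leqnn _) cs cb.
  have [e' de' ->] := span_box (leqnn _) cs' cb'.
  rewrite !(digit_sum_height _ Hk)// => /eqP; rewrite eqr_nat eqn_pmul2r// => /eqP E.
  by apply: eq_bigr => b _; rewrite (digits_inj MJ (leqnn _) de de' E).
Qed.

End Facts.

Lemma realizes_heights k M J n (Lam : 'rV[R]_n -> Prop) : (0 < k)%N ->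
  filtration_data M J -> realizes k M J Lam -> heights k (nth 0%N M (size J)) Lam.
Proof.
move=> k0 MJ [birth [g [G bb Hk LE]]].
have [h1 h2 h3] := span_heights MJ G k0 Hk.
split=> [c /LE|a av|c c' /LE ? ? /LE]; [exact: h1| |exact: h3].
by have [c [/LE]] := h2 a av; exists c.
Qed.

End Heights.

(** * The group determines the data *)

Section Uniqueness.
Variable R : realType.

Lemma chain_ltn M J a b : filtration_data M J -> (a < b)%N -> (b <= size J)%N ->
  (nth 0%N M a < nth 0%N M b)%N.
Proof.
move=> MJ; elim: b => [//|b IH]; rewrite ltnS leq_eqVlt => /orP[/eqP-> bJ|ab bJ].
  exact: (chain_lt MJ).
exact: ltn_trans (IH ab (ltnW bJ)) (chain_lt MJ bJ).
Qed.

Definition absorbed (J : seq {fset nat}) a : nat -> nat :=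
  fun b => (b.+1 \in nth fset0 J a).

Lemma absorbed_digits M J a : filtration_data M J -> (a < size J)%N ->
  digits M a (absorbed J a).
Proof.
move=> MJ aJ b ba; have := ratio_ge2 MJ (ltn_trans ba aJ).
by rewrite /absorbed; case: (_ \in _) => /=; lia.
Qed.

Lemma gen_absorbed n M J (birth : 'I_n -> nat) (g : nat -> 'rV[R]_n) a i :
  generators M J birth g -> (a < size J)%N ->
  (step_ratio M a)%:R * g a.+1 0 i =
    digit_sum (g := g) a (absorbed J a) 0 i + (birth i == a.+1)%:R.
Proof.
move=> G aJ; rewrite (genE G i aJ) digit_sumE; congr (_ + _).
rewrite big_mkcond; apply: eq_bigr => b _; rewrite /absorbed.
by case: (_ \in _); rewrite ?mul1r ?mul0r.
Qed.

Definition one_digit (a r : nat) : nat -> nat := fun b => if b == a then r else 0%N.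

Lemma one_digit_digits M J a r : filtration_data M J -> (a < size J)%N ->
  (r < step_ratio M a)%N -> digits M a.+1 (one_digit a r).
Proof.
move=> MJ aJ ra b; rewrite ltnS => ba; rewrite /one_digit.
case: eqP => [->//|_]; have := ratio_ge2 MJ (leq_ltn_trans ba aJ); lia.
Qed.

Lemma digit_sum_one n (g : nat -> 'rV[R]_n) a r i :
  digit_sum (g := g) a.+1 (one_digit a r) 0 i = r%:R * g a.+1 0 i.
Proof.
rewrite digit_sumE big_ord_recr/= /one_digit eqxx big1 ?add0r// => b _.
by rewrite ltn_eqF// mul0r.
Qed.

Section TwoSystems.
Context {k n : nat}.
Context {M M' : seq nat} {J J' : seq {fset nat}} {birth birth' : 'I_n -> nat}.
Context {g g' : nat -> 'rV[R]_n}.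
Hypothesis k0 : (0 < k)%N.
Hypotheses (MJ : filtration_data M J) (MJ' : filtration_data M' J').
Hypotheses (G : generators M J birth g) (G' : generators M' J' birth' g').
Hypotheses (Hk : gen_heights k M J g) (Hk' : gen_heights k M' J' g').

(** If the other chain had a larger ratio, a multiple of the common generator
would have both a height at least M_a k and a height below it. *)
Lemma step_ratio_le a : (a < size J)%N -> (a < size J')%N ->
  nth 0%N M a = nth 0%N M' a -> g a.+1 = g' a.+1 ->
  (step_ratio M' a <= step_ratio M a)%N.
Proof.
move=> aJ aJ' Ma ga; rewrite leqNgt; apply/negP => rr.
have od := one_digit_digits MJ' aJ' rr.
(* r g differs from the sum of the absorbed generators by the indicator of the
   fresh coordinates, and both lie in the box. *)
have E : digit_sum (g := g') a.+1 (one_digit a (step_ratio M a)) =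
         digit_sum (g := g) a (absorbed J a).
  apply/rowP => i; apply: int_lt1; first last.
  - exact: (digit_sum_box MJ G (ltnW aJ) (absorbed_digits MJ aJ)).
  - exact: (digit_sum_box MJ' G' aJ' od).
  - by rewrite digit_sum_one -ga (gen_absorbed i G aJ) addrAC subrr add0r natr_int.
have := digit_sum_height (absorbed J a) Hk (ltnW aJ).
rewrite -E (digit_sum_height _ Hk' aJ') => /eqP.
rewrite eqr_nat eqn_pmul2r// big_ord_recr/= {2}/one_digit eqxx => /eqP E2.
have := digits_lt MJ (ltnW aJ) (absorbed_digits MJ aJ).
rewrite -E2 -Ma ltnNge => /negP; apply.
apply: leq_trans (leq_addl _ _); apply: leq_pmull.
by have := ratio_ge2 MJ aJ; lia.
Qed.

(** The ratio times the generator has as height a sum of distinct M_b, and such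
a sum, being a digit expansion, determines its terms. *)
Lemma absorbed_eq a : (a < size J)%N -> (a < size J')%N ->
  (forall b, (b <= a.+1)%N -> nth 0%N M b = nth 0%N M' b) ->
  (forall b, (b <= a)%N -> g b.+1 = g' b.+1) ->
  nth fset0 J a = nth fset0 J' a.
Proof.
move=> aJ aJ' MM gg.
have rr : step_ratio M a = step_ratio M' a.
  by rewrite /step_ratio !MM.
have E : digit_sum (g := g) a (absorbed J a) = digit_sum (g := g') a (absorbed J' a).
  apply/rowP => i; apply: int_lt1; first last.
  - exact: (digit_sum_box MJ' G' (ltnW aJ') (absorbed_digits MJ' aJ')).
  - exact: (digit_sum_box MJ G (ltnW aJ) (absorbed_digits MJ aJ)).
  - have e1 := gen_absorbed i G aJ; have := gen_absorbed i G' aJ'.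
    rewrite -rr -gg// e1 => e2.
    rewrite (_ : _ - _ = (birth' i == a.+1)%:R - (birth i == a.+1)%:R); last lra.
    by rewrite rpredB// natr_int.
have := digit_sum_height (absorbed J a) Hk (ltnW aJ).
rewrite E (digit_sum_height _ Hk' (ltnW aJ')) => /eqP.
rewrite eqr_nat eqn_pmul2r// => /eqP E2.
have D' : digits M a (absorbed J' a).
  move=> b ba; rewrite /step_ratio !MM; try lia.
  exact: (absorbed_digits MJ' aJ').
have := digits_inj MJ (ltnW aJ) (absorbed_digits MJ aJ) D'.
rewrite -E2 => /(_ _) D.
apply/fsetP => -[|b].
  have h0 (L : seq {fset nat}) N : filtration_data N L -> (a < size L)%N ->
      (0%N \in nth fset0 L a) = false.
    move=> NL aL; apply/negP; case: NL => _ _ _ /(_ a aL)/fsubsetP/[apply].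
    by move/mem_symbols.
  by rewrite (h0 _ _ MJ)// (h0 _ _ MJ').
have [ba|ab] := ltnP b a.
  have : absorbed J a b = absorbed J' a b.
    apply: D => //; apply: eq_bigr => l _; rewrite MM//; have := ltn_ord l; lia.
  by rewrite /absorbed; do 2 case: (_ \in _).
have h1 (L : seq {fset nat}) N : filtration_data N L -> (a < size L)%N ->
    (b.+1 \in nth fset0 L a) = false.
  move=> NL aL; apply/negP; case: NL => _ _ _ /(_ a aL)/fsubsetP/[apply].
  by move/mem_symbols => /andP[_]; lia.
by rewrite (h1 _ _ MJ)// (h1 _ _ MJ').
Qed.

Lemma gen_box a : (a < size J)%N -> unit_box (g a.+1).
Proof.
move=> aJ i.
have := digit_sum_box MJ G aJ (one_digit_digits MJ aJ (ratio_ge2 MJ aJ)) i.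
by rewrite digit_sum_one mul1r.
Qed.

End TwoSystems.

(** The generator of step a is the only element of height M_a k, and the rest
of the data is how its multiples reduce. *)
Lemma realizes_unique k n (Lam : 'rV[R]_n -> Prop) M J M' J' : (0 < k)%N ->
  filtration_data M J -> filtration_data M' J' ->
  nth 0%N M (size J) = nth 0%N M' (size J') ->
  realizes k M J Lam -> realizes k M' J' Lam -> M = M' /\ J = J'.
Proof.
move=> k0 MJ MJ' vv RM RM'.
have [_ _ hinj] := realizes_heights k0 MJ RM.
case: RM RM' => birth [g [G bb Hk LE]] [birth' [g' [G' bb' Hk' LE']]].
have main a : (a <= size J)%N -> (a <= size J')%N ->
    [/\ forall b, (b <= a)%N -> nth 0%N M b = nth 0%N M' b,
        forall b, (b < a)%N -> nth fset0 J b = nth fset0 J' b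
      & forall b, (b < a)%N -> g b.+1 = g' b.+1].
  elim: a => [_ _|a IH aJ aJ'].
    by split=> // b; rewrite leqn0 => /eqP ->; case: MJ MJ' => _ -> _ _ [_ ->].
  have [MM JJ gg] := IH (ltnW aJ) (ltnW aJ').
  have ga : g a.+1 = g' a.+1.
    have gb := gen_box MJ G aJ; have /LE gL := span_gen g aJ.
    have gb' := gen_box MJ' G' aJ'; have /LE' gL' := span_gen g' aJ'.
    by apply: hinj => //; rewrite Hk// Hk'// MM.
  have rr : step_ratio M a = step_ratio M' a.
    apply/eqP; rewrite eqn_leq.
    have Ma := MM a (leqnn a).
    rewrite (step_ratio_le k0 MJ MJ' G G' Hk Hk' aJ aJ' Ma ga).
    by rewrite (step_ratio_le k0 MJ' MJ G' G Hk' Hk aJ' aJ (esym Ma) (esym ga)).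
  have MM' b : (b <= a.+1)%N -> nth 0%N M b = nth 0%N M' b.
    rewrite leq_eqVlt => /orP[/eqP->|]; last by rewrite ltnS; exact: MM.
    by rewrite (chain_step MJ)// (chain_step MJ')// rr MM.
  have gg' b : (b < a.+1)%N -> g b.+1 = g' b.+1.
    by rewrite ltnS leq_eqVlt => /orP[/eqP->//|]; exact: gg.
  split=> // b; rewrite ltnS leq_eqVlt => /orP[/eqP->|]; last exact: JJ.
  exact: (absorbed_eq k0 MJ MJ' G G' Hk Hk').
(* The chains increase to the same top, so neither can stop before the other. *)
have ss : size J = size J'.
  case: (ltngtP (size J) (size J')) => // lt.
    have [MM _ _] := main _ (leqnn _) (ltnW lt).
    have := chain_ltn MJ' lt (leqnn _).
    by rewrite -vv MM// ltnn.
  have [MM _ _] := main _ (ltnW lt) (leqnn _).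
  have := chain_ltn MJ lt (leqnn _).
  by rewrite vv MM// ltnn.
have [||MM JJ _] := main (size J); rewrite ?ss//.
split.
  apply: (@eq_from_nth _ 0%N); first by case: MJ MJ' => -> _ _ _ [-> _ _ _]; rewrite ss.
  by move=> b; case: MJ => -> _ _ _; rewrite ltnS; exact: MM.
by apply: (@eq_from_nth _ fset0) => // b; exact: JJ.
Qed.

End Uniqueness.

(** * Levels of the classes of a group with prescribed heights *)

Section Fractional.
Variable R : realType.

Definition fracpart n (c : 'rV[R]_n) : 'rV[R]_n :=
  \row_i (c 0 i - (Num.floor (c 0 i))%:~R).

Lemma fracpartE n (c : 'rV[R]_n) i : fracpart c 0 i = c 0 i - (Num.floor (c 0 i))%:~R.
Proof. by rewrite mxE. Qed.

Lemma fracpart_box n (c : 'rV[R]_n) : unit_box (fracpart c).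
Proof.
move=> i; rewrite fracpartE subr_ge0 ltrBlDl.
by have := floor_itv (c 0 i); rewrite intrD.
Qed.

Lemma fracpart_int_row n (c : 'rV[R]_n) : int_row (c - fracpart c).
Proof. by move=> i; rewrite !mxE opprB addrCA subrr addr0 intr_int. Qed.

Lemma fracpart_cong n (c c' : 'rV[R]_n) : int_row (c - c') -> fracpart c = fracpart c'.
Proof.
move=> cc; apply/rowP => i; apply: int_lt1; try exact: fracpart_box.
have := cc i; have := fracpart_int_row c i; have := fracpart_int_row c' i.
rewrite !mxE => h1 h2 h3.
by move: (rpredD (rpredB h3 h2) h1) => /eq_int; apply; ring.
Qed.

Lemma fracpart_id n (c : 'rV[R]_n) : unit_box c -> fracpart c = c.
Proof.
move=> cb; apply/rowP => i; apply: int_lt1 => //; last exact: fracpart_box.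
by have := fracpart_int_row c i; rewrite !mxE -rpredN opprB.
Qed.

Lemma fracpart_le n (c c' : 'rV[R]_n) : int_row (c - c') ->
  (forall i, 0 <= c' 0 i) -> forall i, fracpart c 0 i <= c' 0 i.
Proof.
move=> cc c0 i; rewrite (fracpart_cong cc) fracpartE gerBl ler0z.
by rewrite floor_ge0.
Qed.

End Fractional.

Section Filtration.
Context {R : realType} {n k v : nat} {Lam : 'rV[R]_n -> Prop}.
Hypothesis k0 : (0 < k)%N.
Hypothesis LamB : forall c c', Lam c -> Lam c' -> Lam (c - c').
Hypothesis LamZ : forall c, int_row c -> Lam c.
Hypothesis Lam_tors : exists2 D : nat,
  (0 < D)%N & forall c, Lam c -> int_row (D%:R *: c).
Hypothesis Hts : heights k v Lam.

Lemma Lam0 : Lam 0. Proof. by apply: LamZ => i; rewrite mxE. Qed.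

Lemma LamN c : Lam c -> Lam (- c).
Proof. by move=> /(LamB Lam0); rewrite sub0r. Qed.

Lemma LamD c c' : Lam c -> Lam c' -> Lam (c + c').
Proof. by move=> Lc /LamN/(LamB Lc); rewrite opprK. Qed.

Lemma LamMn c (m : nat) : Lam c -> Lam (m%:R *: c).
Proof.
move=> Lc; elim: m => [|m IH]; first by rewrite scale0r; exact: Lam0.
by rewrite -natr1 scalerDl scale1r; exact: LamD.
Qed.

Lemma Lam_cong c c' : int_row (c - c') -> Lam c -> Lam c'.
Proof. by move=> /LamZ cc Lc; have := LamB Lc cc; rewrite opprB addrCA subrr addr0. Qed.

Lemma Lam_frac c : Lam c -> Lam (fracpart c).
Proof. exact: Lam_cong (fracpart_int_row c). Qed.

(** The heights of the classes are the multiples of k below v k; the absolute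
value only serves to land in nat. *)
Definition level (c : 'rV[R]_n) : nat :=
  (`|Num.floor (\sum_i fracpart c 0 i)|%N %/ k)%N.

Lemma level_of c a : \sum_i fracpart c 0 i = (a * k)%:R -> level c = a.
Proof.
by move=> E; rewrite /level E pmulrn intrKfloor absz_nat mulnK.
Qed.

Lemma levelP c : Lam c ->
  (level c < v)%N /\ \sum_i fracpart c 0 i = (level c * k)%:R.
Proof.
case: Hts => h _ _ /Lam_frac Lc.
by have [a [av aE]] := h _ Lc (fracpart_box c); rewrite (level_of aE).
Qed.

Lemma level_cong c c' : int_row (c - c') -> level c = level c'.
Proof. by move=> cc; rewrite /level (fracpart_cong cc). Qed.

Lemma level_inj c c' : Lam c -> Lam c' -> level c = level c' -> int_row (c - c').
Proof.
move=> Lc Lc' E; case: Hts => _ _ h.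
have Ef : fracpart c = fracpart c'.
  apply: h; try exact: fracpart_box; try exact: Lam_frac.
  by rewrite (levelP Lc).2 (levelP Lc').2 E.
move=> i; have := fracpart_int_row c i; have := fracpart_int_row c' i.
rewrite Ef !mxE => h1 h2; have := rpredB h2 h1.
by move=> /eq_int; apply; ring.
Qed.

Lemma level_surj a : (a < v)%N -> exists c, [/\ Lam c, unit_box c & level c = a].
Proof.
case: Hts => _ h _ /h[c [Lc cb cE]]; exists c; split=> //.
by apply: level_of; rewrite fracpart_id.
Qed.

Lemma level_box c : Lam c -> unit_box c -> \sum_i c 0 i = (level c * k)%:R.
Proof. by move=> Lc cb; rewrite -(levelP Lc).2 fracpart_id. Qed.

(** Reducing modulo 1 can only lower the coordinates. *)
Lemma levelD c c' : Lam c -> Lam c' -> (level (c + c') <= level c + level c')%N.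
Proof.
move=> Lc Lc'; have LD := LamD Lc Lc'.
have [_ e1] := levelP Lc; have [_ e2] := levelP Lc'; have [_ e3] := levelP LD.
rewrite -(@leq_pmul2r k)// -(@ler_nat R) mulnDl natrD -e1 -e2 -e3 -big_split/=.
apply: ler_sum => i _.
have -> : fracpart c 0 i + fracpart c' 0 i = (fracpart c + fracpart c') 0 i.
  by rewrite [RHS]mxE.
apply: fracpart_le => l.
  have := rpredD (fracpart_int_row c l) (fracpart_int_row c' l); rewrite !mxE.
  by move=> /eq_int; apply; ring.
have /andP[f0 _] := fracpart_box c l; have /andP[f0' _] := fracpart_box c' l.
by rewrite mxE addr_ge0.
Qed.

Section Step.
Context {N : nat}.
Hypotheses (N0 : (0 < N)%N) (Nv : (N < v)%N).

(** The part of the group that has been filtered so far. *)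
Definition low c := Lam c /\ (level c < N)%N.

Hypothesis lowB : forall c c', low c -> low c' -> low (c - c').

Lemma low_int c : int_row c -> low c.
Proof.
move=> ci; split; first exact: LamZ.
rewrite (@level_cong c 0) ?subr0// (@level_of 0 0)//.
rewrite fracpart_id; first by rewrite big1// => i _; rewrite mxE.
by move=> i; rewrite mxE lexx ltr01.
Qed.

Lemma lowN c : low c -> low (- c).
Proof.
move=> lc; have l0 : low 0 by apply: low_int => i; rewrite mxE.
by have := lowB l0 lc; rewrite sub0r.
Qed.

Lemma lowD c c' : low c -> low c' -> low (c + c').
Proof. by move=> lc /lowN/(lowB lc); rewrite opprK. Qed.

Lemma low_cong c c' : int_row (c - c') -> low c -> low c'.
Proof.
by move=> cc [Lc]; rewrite (level_cong cc) => ?; split => //; exact: Lam_cong Lc.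
Qed.

Lemma lowMz c (q : int) : low c -> low (q%:~R *: c).
Proof.
move=> lc; have h (m : nat) : low (m%:R *: c).
  elim: m => [|m IH]; first by rewrite scale0r; apply: low_int => i; rewrite mxE.
  by rewrite -natr1 scalerDl scale1r; exact: lowD.
by case: q => m; rewrite ?NegzE ?mulrNz ?scaleNr -pmulrn//; apply: lowN.
Qed.

Section Generator.
Context {g : 'rV[R]_n} {m : nat}.
Hypotheses (Lg : Lam g) (gb : unit_box g) (gN : level g = N).
Hypothesis mg : low (m%:R *: g).
Hypothesis m_min : forall l, (0 < l < m)%N -> ~ low (l%:R *: g).

(** By minimality of m the classes h + t g are new for each t, so their level is
at least t N, all levels below being taken; subadditivity bounds it by
level h + t N, and induction on level h rules out the smaller values. *)
Lemma level_shift t h : (t < m)%N -> low h ->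
  level (h + t%:R *: g) = (level h + t * N)%N.
Proof.
elim/ltn_ind: t h => t IH h tm lh.
have Lth : Lam (h + t%:R *: g) by apply: LamD; [case: lh|exact: LamMn].
case: t => [|t] in IH tm Lth *; first by rewrite scale0r addr0 addn0.
have up h' : low h' -> (level (h' + t.+1%:R *: g) <= level h' + t.+1 * N)%N.
  move=> lh'; rewrite -natr1 scalerDl scale1r addrA mulSnr addnA.
  rewrite -(IH t (ltnSn t) h' (ltnW tm) lh') -gN.
  by apply: levelD => //; apply: LamD; [case: lh'|exact: LamMn].
have dn h' : low h' -> (t.+1 * N <= level (h' + t.+1%:R *: g))%N.
  move=> lh'; rewrite leqNgt; apply/negP => lt.
  (* x is in the class of y + t' g for some low y and some t' < t.+1, so that
     (t.+1 - t') g would be low. *)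
  set x := h' + _ in lt.
  have Lx : Lam x by apply: LamD; [case: lh'|exact: LamMn].
  have t't : (level x %/ N < t.+1)%N by rewrite ltn_divLR.
  have rN : (level x %% N < N)%N by rewrite ltn_pmod.
  have [y [Ly _ yE]] := level_surj (ltn_trans rN Nv).
  have ly : low y by split; rewrite ?yE.
  have E : level (y + (level x %/ N)%:R *: g) = level x.
    by rewrite (IH _ t't y (ltn_trans t't tm) ly) yE addnC -divn_eq.
  have := level_inj Lx (LamD Ly (LamMn (level x %/ N)%N Lg)) (esym E).
  move=> xy; apply: (@m_min (t.+1 - level x %/ N)%N).
    by rewrite subn_gt0 t't/=; apply: leq_ltn_trans tm; rewrite leq_subr.
  rewrite natrB ?(ltnW t't)//.
  apply: low_cong (lowB ly lh') => i; have := xy i; rewrite -rpredN !mxE.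
  by move=> /eq_int; apply; ring.
elim/ltn_ind: {h}(level h) {-2}h (erefl (level h)) lh {Lth} => a IHa h ha lh.
have := up h lh; have := dn h lh; set z := level (h + _); rewrite ha => z1 z2.
apply/eqP; rewrite eqn_leq z2/= leqNgt; apply/negP => z3.
(* The level z is already taken by the shift of a low class of level b < a. *)
pose b := (z - t.+1 * N)%N; have ba : (b < a)%N by rewrite /b; lia.
have bN : (b < N)%N by apply: ltn_trans ba _; rewrite -ha; case: lh.
have [y [Ly _ yE]] := level_surj (ltn_trans bN Nv).
have ly : low y by split; rewrite ?yE.
have E := IHa b ba y yE ly.
have zE : level (h + t.+1%:R *: g) = level (y + t.+1%:R *: g).
  by rewrite E ?yE -/z /b subnK.
have := level_inj (LamD lh.1 (LamMn t.+1 Lg)) (LamD Ly (LamMn t.+1 Lg)) zE.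
rewrite opprD addrACA subrr addr0 => /level_cong.
by rewrite ha yE; lia.
Qed.

(** Each unit carried out of a coordinate would lower the height by 1, while
level_shift says that nothing is lost. *)
Lemma shift_box t h : (t < m)%N -> low h -> unit_box h ->
  unit_box (h + t%:R *: g).
Proof.
move=> tm lh hb; set x := h + _.
have x0 i : 0 <= x 0 i.
  rewrite !mxE addr_ge0 ?mulr_ge0//; [by case/andP: (hb i)|by case/andP: (gb i)].
have fx i : fracpart x 0 i <= x 0 i.
  by apply: fracpart_le => // l; rewrite subrr mxE.
have Lx : Lam x by apply: LamD; [case: lh|exact: LamMn].
have S : \sum_i (x 0 i - fracpart x 0 i) = 0.
  rewrite big_split/= sumrN (levelP Lx).2 level_shift//.
  under eq_bigr do rewrite !mxE.
  rewrite big_split/= -mulr_sumr (level_box lh.1 hb) (level_box Lg gb) gN.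
  by rewrite -natrM -natrD mulnA -mulnDl subrr.
have -> : x = fracpart x.
  apply/rowP => i; apply/eqP; rewrite -subr_eq0.
  move/eqP: S; rewrite psumr_eq0 => [/allP/(_ i)|l _]; last by rewrite subr_ge0.
  by rewrite mem_index_enum => /(_ isT).
exact: fracpart_box.
Qed.

Lemma shift_mod c : low c -> (0 < m)%N -> forall t : int,
  exists2 r, (r < m)%N & exists2 h, low h & c + t%:~R *: g = h + r%:R *: g.
Proof.
move=> lc m0 t.
have tm0 : (0 <= t %% m)%Z by rewrite modz_ge0//; lia.
have tm1 : (t %% m < m)%Z by rewrite ltz_pmod//; lia.
exists `|(t %% m)%Z|%N; first by lia.
exists (c + (t %/ m)%Z%:~R *: (m%:R *: g)).
  by apply: lowD => //; exact: lowMz.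
rewrite {1}(divz_eq t m) -addrA scalerA -scalerDl; congr (_ + _ *: _).
by rewrite intrD intrM -pmulrn -{1}(gez0_abs tm0) pmulrn.
Qed.

End Generator.

(** Take m to be the order modulo the low classes of an element of level N: the
classes h + t g with t < m then fill the levels below m N. *)
Lemma next_generator : exists (g : 'rV[R]_n) (m : nat),
  [/\ Lam g, unit_box g & \sum_i g 0 i = (N * k)%:R] /\
  [/\ (2 <= m)%N, (m * N <= v)%N, low (m%:R *: g),
      forall h, low h -> unit_box h -> unit_box (h + m.-1%:R *: g)
    & forall c, (Lam c /\ (level c < m * N)%N) <->
        exists t : int, low (c - t%:~R *: g)].
Proof.
have [g [Lg gb gN]] := level_surj Nv.
have [D D0 Dint] := Lam_tors.
have exm : exists m, (0 < m)%N && `[< low (m%:R *: g) >].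
  by exists D; rewrite D0/=; apply/asboolP/low_int/Dint.
pose m := ex_minn exm.
have [m0 mg m_min] : [/\ (0 < m)%N, low (m%:R *: g)
    & forall l, (0 < l < m)%N -> ~ low (l%:R *: g)].
  rewrite /m; case: ex_minnP => {}m /andP[m0 /asboolP mg] mmin; split=> // l.
  move=> /andP[l0 lm] ll; have := mmin l; rewrite l0; case: asboolP => // _ /(_ isT).
  by rewrite leqNgt lm.
have m2 : (2 <= m)%N.
  rewrite ltn_neqAle m0 andbT; apply/eqP => m1.
  by move: mg; rewrite -m1 scale1r => -[_]; rewrite gN ltnn.
have m1 : (m.-1 < m)%N by rewrite prednK.
have shift := @level_shift g m Lg gN m_min.
exists g, m; split; first by split=> //; rewrite level_box// gN.
split=> //.
- have [h [Lh hb hE]] : exists h, [/\ Lam h, unit_box h & level h = N.-1].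
    by apply: level_surj; lia.
  have lh : low h by split=> //; rewrite hE; lia.
  have := shift m.-1 h m1 lh; have [+ _] := levelP (LamD Lh (LamMn m.-1 Lg)).
  move=> /[swap] ->; rewrite hE.
  have : (m * N = m.-1 * N + N)%N by rewrite -{1}(prednK m0) mulSnr.
  lia.
- by move=> h lh hb; apply: (@shift_box g m).
- move=> c; split.
  + move=> [Lc cm].
    have t't : (level c %/ N < m)%N by rewrite ltn_divLR.
    have rN : (level c %% N < N)%N by rewrite ltn_pmod.
    have [y [Ly _ yE]] := level_surj (ltn_trans rN Nv).
    have ly : low y by split; rewrite ?yE.
    exists (level c %/ N)%N; apply: (low_cong _ ly) => i.
    have E : level (y + (level c %/ N)%:R *: g) = level c.
      rewrite (shift _ _ t't ly) yE addnC -divn_eq. done.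
    have := level_inj (LamD Ly (LamMn (level c %/ N)%N Lg)) Lc E i.
    by rewrite !mxE -pmulrn => /eq_int; apply; ring.
  + move=> [t lt]; have [r rm [h lh]] := shift_mod gN mg lt m0 t.
    rewrite subrK => ->; rewrite shift//; split.
      by apply: LamD; [case: lh|exact: LamMn].
    apply: leq_trans (_ : r.+1 * N <= _)%N; last by rewrite leq_mul2r rm orbT.
    by rewrite mulSn ltn_add2r; case: lh.
Qed.

End Step.
End Filtration.

(** * Every such group comes from chain data *)

Section Existence.
Variable R : realType.

Lemma symbols_rcons J S a : (a <= size J)%N ->
  symbols (rcons J S) a = symbols J a.
Proof.
elim: a => [//|a IH] aJ /=; rewrite IH 1?ltnW//.
by rewrite nth_rcons aJ.
Qed.

(** Without fresh coordinates the height of a generator would come from the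
generators it absorbs alone, which is too small. *)
Lemma born_exists k n M J (birth : 'I_n -> nat) (g : nat -> 'rV[R]_n) a :
  (0 < k)%N -> filtration_data M J -> generators M J birth g -> gen_heights k M J g ->
  (a < size J)%N -> exists i, birth i = a.+1.
Proof.
move=> k0 MJ G Hk aJ; apply: contrapT => /forallNP nb.
have E : (step_ratio M a * (nth 0%N M a * k))%:R =
    ((\sum_(b < a) absorbed J a b * nth 0%N M b) * k)%:R :> R.
  rewrite natrM -(Hk a aJ) -(digit_sum_height _ Hk (ltnW aJ)) mulr_sumr.
  apply: eq_bigr => i _; rewrite (gen_absorbed i G aJ).
  by case: eqP => [/nb//|_]; rewrite addr0.
move/eqP: E; rewrite eqr_nat mulnA eqn_pmul2r// -(chain_step MJ)// => /eqP E.
have := digits_lt MJ (ltnW aJ) (absorbed_digits MJ aJ).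
by rewrite -E ltnNge ltnW// (chain_lt MJ).
Qed.

Section Extend.
Context {k n : nat} {Lam : 'rV[R]_n -> Prop}.
Context {M : seq nat} {J : seq {fset nat}} {birth : 'I_n -> nat}.
Context {g : nat -> 'rV[R]_n}.
Hypothesis k0 : (0 < k)%N.
Hypothesis MJ : filtration_data M J.
Hypothesis G : generators M J birth g.
Hypothesis Hk : gen_heights k M J g.
Context {x : 'rV[R]_n} {m : nat}.
Hypotheses (xb : unit_box x) (xN : \sum_i x 0 i = (nth 0%N M (size J) * k)%:R).
Hypothesis m2 : (2 <= m)%N.
Hypothesis xspan : in_span (size J) g (m%:R *: x).
Hypothesis xbox : forall h, in_span (size J) g h -> unit_box h ->
  unit_box (h + m.-1%:R *: x).

Let s := size J.

Lemma mx_le i : m%:R * x 0 i <= 2 * (m.-1%:R * x 0 i).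
Proof.
rewrite mulrA ler_wpM2r//; first by case/andP: (xb i).
by rewrite -natrM ler_nat; lia.
Qed.

(** The largest low digit vector is 1 minus the root sum and stays in the box
when shifted by (m - 1) x, while m <= 2 (m - 1). *)
Lemma mx_born i : (birth i <= s)%N -> m%:R * x 0 i < 2 * root_sum J g s 0 i.
Proof.
move=> bs; apply: le_lt_trans (mx_le i) _; rewrite ltr_pM2l//.
pose e b := (step_ratio M b).-1.
have de : digits M s e.
  by move=> b bs'; have := ratio_ge2 MJ bs'; rewrite /e; lia.
have := xbox (digit_sum_span (g := g) s e) (digit_sum_box MJ G (leqnn _) de) i.
move=> /andP[_]; rewrite !mxE.
have -> : digit_sum (g := g) s e 0 i = 1 - root_sum J g s 0 i.
  have := top_digits MJ G i (leqnn s); rewrite bs digit_sumE => <-.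
  apply: eq_bigr => b _; congr (_ * _); rewrite /e -subn1 natrB//.
  by have := ratio_ge2 MJ (ltn_ord b); lia.
by set u := root_sum _ _ _ _ _; set y := _ * _; lra.
Qed.

Lemma mx_unborn i : m%:R * x 0 i < 2.
Proof.
have zs := span0 s g.
have zb : unit_box (0 : 'rV[R]_n) by move=> l; rewrite mxE lexx ltr01.
have /andP[_] := xbox zs zb i; rewrite !mxE add0r => h.
by have := mx_le i; lra.
Qed.

(** Expand m x in digits. At a coordinate born with generator b, digit b weighs
g b, whereas m x stays below twice the root sum: by root_sum_le the digit is 0
if b has been absorbed and at most 1 if b is a root. *)
Lemma mx_roots : exists S : {fset nat},
  (S `<=` symbols J s)%fset /\
  forall i, m%:R * x 0 i = \sum_(b < s | b.+1 \in S) g b.+1 0 i +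
    ((s < birth i)%N && (m%:R * x 0 i == 1))%:R.
Proof.
have [t tE] := xspan; have [e [de eE]] := span_digits MJ G t (leqnn s).
have int_diff i : m%:R * x 0 i - digit_sum (g := g) s e 0 i \is a Num.int.
  by have := rpredD (tE i) (eE i); rewrite addrA subrK mxE.
have eb := digit_sum_box MJ G (leqnn s) de.
have x0 i : 0 <= m%:R * x 0 i by rewrite mulr_ge0//; case/andP: (xb i).
have born_eq i : (birth i <= s)%N -> m%:R * x 0 i = digit_sum (g := g) s e 0 i.
  move=> bs; apply: int_lt1 => //; rewrite x0/=.
  have b0 : (0 < birth i)%N by case: G.
  have ib : birth i = (birth i).-1.+1 by rewrite prednK.
  have bs' : ((birth i).-1 < s)%N by rewrite -ib.
  have [_] := root_sum_le MJ G bs' (leqnn s) ib.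
  have := gen_birth MJ G bs' ib; have := mx_born bs.
  have g0 := gen_ge0 MJ G i bs'.
  have r2 : 2 <= (step_ratio M (birth i).-1)%:R :> R.
    by rewrite ler_nat (ratio_ge2 MJ).
  have : 2 * g (birth i).-1.+1 0 i <=
      (step_ratio M (birth i).-1)%:R * g (birth i).-1.+1 0 i.
    by rewrite ler_wpM2r.
  case: ifP => _; lra.
have unborn i : (s < birth i)%N -> digit_sum (g := g) s e 0 i = 0.
  move=> sb; rewrite digit_sumE big1// => b _.
  rewrite (gen_unborn MJ G) ?mulr0//.
  exact: leq_ltn_trans sb.
have e01 b : (b < s)%N -> (e b <= (b.+1 \in symbols J s))%N.
  move=> bs; have [i ib] := born_exists k0 MJ G Hk bs.
  have bs' : (birth i <= s)%N by rewrite ib.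
  have := mx_born bs'; rewrite born_eq//.
  have [_] := root_sum_le MJ G bs (leqnn s) ib.
  have g0 := gen_birth_gt0 MJ G bs ib.
  set u := root_sum _ _ _ _ _ => hu hd.
  have ed : (e b)%:R * g b.+1 0 i <= digit_sum (g := g) s e 0 i.
    rewrite digit_sumE (bigD1 (Ordinal bs))//= lerDl sumr_ge0// => l _.
    by rewrite mulr_ge0// (gen_ge0 MJ G).
  move: hu; case: ifP => _ hu.
    have : (e b)%:R * g b.+1 0 i < 2 * g b.+1 0 i by lra.
    by rewrite ltr_pM2r// ltr_nat ltnS.
  have : (e b)%:R * g b.+1 0 i < 1 * g b.+1 0 i by lra.
  by rewrite ltr_pM2r// ltrn1 ltnS. 
pose S := [fset a in symbols J s | e a.-1 == 1%N]%fset.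
have SE b : (b < s)%N -> e b = (b.+1 \in S).
  move=> bs; rewrite !inE/=; have := e01 b bs.
  by case: (_ \in symbols J s) => /=; case: (e b) => [|[|]].
exists S; split; first by apply/fsubsetP => a; rewrite !inE => /andP[].
move=> i; have <- : digit_sum (g := g) s e 0 i = \sum_(b < s | b.+1 \in S) g b.+1 0 i.
  rewrite digit_sumE [RHS]big_mkcond; apply: eq_bigr => b _.
  by rewrite SE//; case: (_ \in S); rewrite ?mul1r ?mul0r.
case: (leqP (birth i) s) => bs /=; first by rewrite addr0 born_eq.
have := int_diff i; rewrite unborn// subr0 add0r => /intrP[z zE].
have := x0 i; have := mx_unborn i; rewrite zE.
rewrite ler0z (_ : 2 = 2%:~R :> R)// ltr_int => z2 z0.
have [->|->] : z = 0 \/ z = 1 by lia.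
by rewrite mulr0z eq_sym oner_eq0.
by rewrite mulr1z eqxx.
Qed.

(** The fresh coordinates of the new step are those where m x wraps to 1; the
remaining ones are postponed. *)
Let birth' i : nat :=
  if (birth i <= s)%N then birth i else if m%:R * x 0 i == 1 then s.+1 else s.+2.

Lemma extend_generators S :
  (S `<=` symbols J s)%fset ->
  (forall i, m%:R * x 0 i = \sum_(b < s | b.+1 \in S) g b.+1 0 i +
    ((s < birth i)%N && (m%:R * x 0 i == 1))%:R) ->
  let M' := rcons M (m * nth 0%N M s)%N in let J' := rcons J S in
  let g' := fun a => if a == s.+1 then x else g a in
  [/\ filtration_data M' J', exists b', generators M' J' b' g' & gen_heights k M' J' g'].
Proof.
move=> Ssub xE M' J' g'.
have sM : size M = s.+1 by case: MJ.
have nM b : (b <= s)%N -> nth 0%N M' b = nth 0%N M b.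
  by move=> bs; rewrite nth_rcons sM ltnS bs.
have nMs : nth 0%N M' s.+1 = (m * nth 0%N M s)%N.
  by rewrite nth_rcons sM ltnn eqxx.
have nJ b : (b < s)%N -> nth fset0 J' b = nth fset0 J b.
  by move=> bs; rewrite nth_rcons bs.
have nJs : nth fset0 J' s = S by rewrite nth_rcons ltnn eqxx.
have M0 : (0 < nth 0%N M s)%N := chain_gt0 MJ (leqnn _).
have g'E b : (b < s)%N -> g' b.+1 = g b.+1.
  by move=> bs; rewrite /g' eqSS ltn_eqF.
have rs : step_ratio M' s = m.
  by rewrite /step_ratio nMs nM// mulnK.
split.
- split; first by rewrite !size_rcons sM.
  + by rewrite nM//; case: MJ.
  + move=> a; rewrite size_rcons ltnS leq_eqVlt => /orP[/eqP->|aJ].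
      by rewrite nMs nM// dvdn_mull//= ltn_Pmull.
    by rewrite (nM _ (ltnW aJ)) (nM _ aJ); case: MJ => _ _ + _; apply.
  + move=> a; rewrite size_rcons ltnS leq_eqVlt => /orP[/eqP->|aJ].
      by rewrite nJs symbols_rcons.
    by rewrite nJ// symbols_rcons 1?ltnW//; case: MJ => _ _ _; apply.
- exists birth'; split.
    by move=> i; rewrite /birth'; case: ifP => _; [case: G|case: ifP].
  move=> a; rewrite size_rcons ltnS leq_eqVlt => /orP[/eqP->|aJ].
    apply/rowP => i; rewrite rs !mxE summxE nJs /g' eqxx xE.
    congr (_ + _).
      by apply: eq_bigr => b _; rewrite eqSS ltn_eqF.
    rewrite /birth'; case: (leqP (birth i) s) => bs /=.
      by rewrite ltn_eqF.
    by case: ifP => _; rewrite ?eqxx// gtn_eqF.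
  rewrite nJ// g'E// /step_ratio (nM _ (ltnW aJ)) (nM _ aJ).
  have [_ /(_ a aJ) GE] := G.
  rewrite [LHS]GE; congr (_ + _).
    by apply: eq_bigr => b _; rewrite g'E// (ltn_trans _ aJ).
  apply/rowP => i; rewrite !mxE /birth'.
  case: (leqP (birth i) s) => //= bs.
  rewrite (gtn_eqF (leq_ltn_trans aJ bs)).
  by case: ifP => _; rewrite gtn_eqF// ltnS ltnW.
- move=> a; rewrite size_rcons ltnS leq_eqVlt => /orP[/eqP->|aJ].
    by rewrite /g' eqxx nM.
  by rewrite g'E// (nM _ (ltnW aJ)) Hk.
Qed.

End Extend.

(** Adjoin the element of height M_j k to the classes of height below M_j k,
until the whole group is reached. A coordinate that is never born is integral
on the whole group. *)
Lemma heights_realizes k v n (Lam : 'rV[R]_n -> Prop) : (0 < k)%N -> (0 < v)%N ->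
  (forall c c', Lam c -> Lam c' -> Lam (c - c')) ->
  (forall c, int_row c -> Lam c) ->
  (exists2 D : nat, (0 < D)%N & forall c, Lam c -> int_row (D%:R *: c)) ->
  heights k v Lam ->
  (forall i, exists2 c, Lam c & c 0 i \isn't a Num.int) ->
  exists M J, [/\ filtration_data M J, nth 0%N M (size J) = v & realizes k M J Lam].
Proof.
move=> k0 v0 LamB LamZ tors Hts nz.
suff main : forall e M J birth g, filtration_data M J -> generators M J birth g ->
    gen_heights k M J g -> (nth 0%N M (size J) <= v)%N ->
    (v - nth 0%N M (size J) <= e)%N ->
    (forall c, low (k := k) (Lam := Lam) (N := nth 0%N M (size J)) c <->
       in_span (size J) g c) ->
  exists M J, [/\ filtration_data M J, nth 0%N M (size J) = v & realizes k M J Lam].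
  (* Initially no coordinate has been reached: all births are beyond step 0. *)
  apply: (main v [:: 1%N] [::] (fun=> 1%N) (fun=> 0)) => //=; rewrite ?leq_subr//.

  - move=> c; split.
    + move=> [Lc]; rewrite ltnS leqn0 => /eqP lc; exists (fun=> 0) => i.
      rewrite big_ord0 subr0.
      have L0 : Lam 0 by apply: LamZ => l; rewrite mxE.
      have := level_inj k0 LamB LamZ Hts Lc L0.
      rewrite lc subr0; apply.
      rewrite (@level_of _ _ _ k0 0 0)// fracpart_id ?big1// => [l _|l]; rewrite mxE//.
      by rewrite lexx ltr01.
    + move=> [t tE]; apply: (low_int k0 LamZ) => // i.
      by have := tE i; rewrite big_ord0 subr0.
have done_case M J birth g : filtration_data M J -> generators M J birth g ->
    gen_heights k M J g -> nth 0%N M (size J) = v ->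
    (forall c, low (k := k) (Lam := Lam) (N := nth 0%N M (size J)) c <->
       in_span (size J) g c) ->
    exists M J, [/\ filtration_data M J, nth 0%N M (size J) = v & realizes k M J Lam].
  move=> MJ G Hk Ev LE; have LE' c : Lam c <-> in_span (size J) g c.
    rewrite -LE; split=> [Lc|[]//]; split=> //; rewrite Ev.
    by case: (levelP k0 LamB LamZ Hts Lc).
  exists M, J; split=> //; exists birth, g; split=> // i.
  rewrite leqNgt; apply/negP => ui; have [c /LE'[t tE]] := nz i.
  have := tE i; rewrite big1 ?subr0 => [->//|b _].
  by rewrite (gen_unborn MJ G) ?mulr0//; exact: leq_ltn_trans ui.
elim=> [|e IH] M J birth g MJ G Hk Mv ve LE;
  have [Ev|Nv] := eqVneq (nth 0%N M (size J)) v.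
- exact: (done_case _ _ _ _ MJ G Hk Ev LE).
- by lia.
- exact: (done_case _ _ _ _ MJ G Hk Ev LE).
have {Nv}Nv : (nth 0%N M (size J) < v)%N by rewrite ltn_neqAle Nv.
have N0 := chain_gt0 MJ (leqnn (size J)).
have lowB : forall c c', low (k := k) (Lam := Lam) (N := nth 0%N M (size J)) c ->
    low (k := k) (Lam := Lam) (N := nth 0%N M (size J)) c' ->
    low (k := k) (Lam := Lam) (N := nth 0%N M (size J)) (c - c').
  by move=> c c' /LE sc /LE sc'; apply/LE/span_sub.
have [x [m [[Lx xb xN] [m2 mv /LE mx box lowE]]]] :=
  next_generator k0 LamB LamZ tors Hts N0 Nv lowB.
have xbox h : in_span (size J) g h -> unit_box h -> unit_box (h + m.-1%:R *: x).
  by move=> /LE; exact: box.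
have [S [Ssub xE]] := mx_roots k0 MJ G Hk xb m2 mx xbox.
have [MJ' [birth' G'] Hk'] := extend_generators MJ G Hk xN m2 Ssub xE.
have sM : size M = (size J).+1 by case: MJ.
have nMs : nth 0%N (rcons M (m * nth 0%N M (size J))) (size J).+1 =
    (m * nth 0%N M (size J))%N.
  by rewrite nth_rcons sM ltnn eqxx.
apply: (IH _ _ birth' _ MJ' G' Hk'); rewrite size_rcons nMs//.
  have : (nth 0%N M (size J) < m * nth 0%N M (size J))%N by rewrite ltn_Pmull.
  by lia.
move=> c; apply: (iff_trans (lowE c)); split.
  move=> [t /LE[u uE]].
  exists (fun b => if b == size J then t else u b) => i.
  rewrite big_ord_recr/= !eqxx.
  rewrite (_ : \sum_(_ < _) _ = \sum_(b < size J) (u b)%:~R * g b.+1 0 i).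
    by have := uE i; rewrite !mxE => /eq_int; apply; ring.
  by apply: eq_bigr => b _; rewrite eqSS ltn_eqF.
move=> [u uE]; exists (u (size J)); apply/LE; exists u => i.
have := uE i; rewrite big_ord_recr/= eqxx.
rewrite (_ : \sum_(_ < _) _ = \sum_(b < size J) (u b)%:~R * g b.+1 0 i).
  by rewrite !mxE => /eq_int; apply; ring.
by apply: eq_bigr => b _; rewrite eqSS ltn_eqF.
Qed.

End Existence.

(** * Convex hulls and vertices *)

Section Convexity.
Variable R : realType.

Lemma convexP d (A : set 'rV[R]_d) : @convex_set R 'rV[R]_d A <->
  forall x y (t : R), A x -> A y -> 0 <= t <= 1 -> A (t *: x + (1 - t) *: y).
Proof.
split=> [cA x y t Ax Ay /andP[t0 t1]|cA x y l /set_mem Ax /set_mem Ay].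
  have := cA x y (Itv01 t0 t1); rewrite !inE => /(_ Ax Ay).
  by [].
by rewrite inE; apply: (cA x y l%:num) => //; rewrite ge0 le1.
Qed.

Definition weights n (a : 'I_n -> R) : Prop :=
  (forall i, 0 <= a i) /\ \sum_i a i = 1.

Lemma convex_comb d n (A : set 'rV[R]_d) (V : 'I_n -> 'rV[R]_d) a :
  @convex_set R 'rV[R]_d A -> (forall i, A (V i)) -> weights a ->
  A (\sum_i a i *: V i).
Proof.
move=> /convexP cA; elim: n V a => [|n IH] V a AV [a0 a1].
  by move: a1; rewrite big_ord0 => /eqP; rewrite eq_sym oner_eq0.
rewrite big_ord_recl in a1; rewrite big_ord_recl.
have S0 : 0 <= \sum_(i < n) a (lift ord0 i) by exact: sumr_ge0.
have [S|SN] := eqVneq (\sum_(i < n) a (lift ord0 i)) 0.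
  have -> : a ord0 = 1 by lra.
  rewrite scale1r big1 ?addr0//.
  move=> i _; move/eqP: S; rewrite psumr_eq0// => /allP/(_ i).
  by rewrite mem_index_enum => /(_ isT)/= /eqP ->; rewrite scale0r.
have [h1 h2] : 0 <= a ord0 /\ \sum_(i < n) a (lift ord0 i) = 1 - a ord0.
  by split=> //; lra.
have -> : \sum_(i < n) a (lift ord0 i) *: V (lift ord0 i) =
    (1 - a ord0) *: \sum_(i < n) (a (lift ord0 i) / (1 - a ord0)) *: V (lift ord0 i).
  rewrite scaler_sumr; apply: eq_bigr => i _; rewrite scalerA mulrC divfK//.
  by rewrite -h2.
apply: cA; first exact: AV; last by rewrite h1/=; lra.
apply: IH => [i|]; first exact: AV.
split=> [i|]; first by rewrite divr_ge0// -h2.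
by rewrite -mulr_suml h2 divff// -h2.
Qed.

Lemma conv_hull_range d n (V : 'I_n -> 'rV[R]_d) :
  conv_hull (range V) = [set \sum_i a i *: V i | a in @weights n].
Proof.
apply/seteqP; split.
  apply: smallest_sub.
    apply/convexP => x y t [a [a0 a1] <-] [b [b0 b1] <-] /andP[t0 t1].
    exists (fun i => t * a i + (1 - t) * b i).
      split=> [i|]; first by rewrite addr_ge0// mulr_ge0// subr_ge0.
      by rewrite big_split/= -!mulr_sumr a1 b1; ring.
    rewrite !scaler_sumr -big_split/=; apply: eq_bigr => i _.
    by rewrite !scalerA -scalerDl.
  move=> _ [i _ <-]; exists (fun j => (j == i)%:R).
    split=> [j|]; first by case: (j == i).
    by rewrite (bigD1 i)//= eqxx big1 ?addr0// => j /negPf ->.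
  by rewrite (bigD1 i)//= eqxx scale1r big1 ?addr0// => j /negPf ->; rewrite scale0r.
move=> _ [a wa <-] A [cA AV]; apply: convex_comb => // i.
by apply: AV; exists i.
Qed.

Lemma hull_vertex d n (V : 'I_n -> 'rV[R]_d) i : conv_hull (range V) (V i).
Proof. by apply: sub_gen_smallest; exists i. Qed.

Lemma hull_convex d (A : set 'rV[R]_d) : @convex_set R 'rV[R]_d (conv_hull A).
Proof.
apply/convexP => y z t Py Pz t01 B [/[dup] cB /convexP cB' AB].
by apply: cB' => //; [exact: Py|exact: Pz].
Qed.

(** A vertex can be removed from a convex set, so hulls keep their vertices
among the generators. *)
Lemma vertices_hull d (A : set 'rV[R]_d) : vertices (conv_hull A) `<=` A.
Proof.
move=> x [Px ext]; apply: contrapT => Ax.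
have : (conv_hull A `\ x) x.
  apply: Px; split; last first.
    move=> y Ay; split; first exact: sub_gen_smallest.
    by move=> yx; rewrite /= yx in Ay.
  have /convexP cP := @hull_convex d A.
  apply/convexP => y z t [Py yx] [Pz zx] /[dup] t01 /andP[t0 t1].
  split; first exact: cP.
  move=> /= E; have [t00|tN0] := eqVneq t 0.
    by apply: zx; rewrite /= -E t00 scale0r add0r subr0 scale1r.
  have [t11|tN1] := eqVneq t 1.
    by apply: yx; rewrite /= -E t11 subrr scale0r addr0 scale1r.
  have t01' : 0 < t < 1 by rewrite !lt_neqAle t0 t1 tN1 eq_sym tN0.
  by have [/yx] := ext y z t Py Pz t01' (esym E).
by case=> _; apply.
Qed.

Lemma affine_vertex d n (V : 'I_n -> 'rV[R]_d) i : affinely_independent V ->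
  vertices (conv_hull (range V)) (V i).
Proof.
move=> aV; split; first exact: hull_vertex.
move=> y z t; rewrite conv_hull_range => -[a [a0 a1] <-] [b [b0 b1] <-] /andP[t0 t1] E.
have ab j : (j == i)%:R - (t * a j + (1 - t) * b j) = 0.
  apply: (aV (fun j => (j == i)%:R - (t * a j + (1 - t) * b j))).
    rewrite sumrB big_split/= -!mulr_sumr a1 b1 (bigD1 i)//= eqxx/= big1; first by ring.
    by move=> l /negPf ->.
  under eq_bigr do rewrite scalerBl scalerDl -!scalerA.
  rewrite sumrB big_split/= -!scaler_sumr -E (bigD1 i)//= eqxx.
  rewrite big1 ?addr0 ?scale1r ?subrr//.
  by move=> l /negPf ->; rewrite scale0r.
have zero j : j != i -> a j = 0 /\ b j = 0.
  move=> ji; have := ab j; rewrite (negPf ji) => h.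
  have h1 : 0 <= t * a j by rewrite mulr_ge0// ltW.
  have h2 : 0 <= (1 - t) * b j by rewrite mulr_ge0// subr_ge0 ltW.
  have [/eqP + /eqP] : t * a j = 0 /\ (1 - t) * b j = 0.
    by move: h h1 h2; set X := t * a j; set Y := (1 - t) * b j => /=; split; lra.
  by rewrite !mulf_eq0 subr_eq0 (gt_eqF t0) (gt_eqF t1)/= => /eqP -> /eqP ->.
have single c : \sum_j c j = 1 -> (forall j, j != i -> c j = 0) ->
    \sum_j c j *: V j = V i.
  move=> c1 c0; move: c1; rewrite (bigD1 i)//= big1 ?addr0 => [ci|j /c0//].
  by rewrite (bigD1 i)//= ci scale1r big1 ?addr0// => j /c0 ->; rewrite scale0r.
by split; apply: single => // j /zero[].
Qed.

End Convexity.

(** * The group of a simplex *)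

Section Simplex.
Variable R : realType.

Lemma int_mxP m n (A : 'M[R]_(m, n)) : (forall i j, A i j \is a Num.int) ->
  exists B : 'M[int]_(m, n), A = map_mx intr B.
Proof.
move=> AZ; exists (map_mx Num.floor A); apply/matrixP => i j.
by rewrite !mxE floorK.
Qed.

Lemma ZlatticeP d (x : 'rV[R]_d) : Zlattice x <-> int_row x.
Proof.
split=> [[z _ <-] i|xi]; first by rewrite mxE intr_int.
have [z zE] : exists z : 'rV[int]_d, x = map_mx intr z.
  by apply: int_mxP => i j; rewrite ord1.
by exists z.
Qed.

Lemma int_row_mulmx m n (x : 'rV[R]_m) (A : 'M[R]_(m, n)) : int_row x ->
  (forall i j, A i j \is a Num.int) -> int_row (x *m A).
Proof. by move=> xi Ai j; rewrite mxE rpred_sum// => i _; rewrite rpredM. Qed.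

Lemma int_rowD n (x y : 'rV[R]_n) : int_row x -> int_row y -> int_row (x + y).
Proof. by move=> xi yi i; rewrite mxE rpredD. Qed.

Lemma int_rowB n (x y : 'rV[R]_n) : int_row x -> int_row y -> int_row (x - y).
Proof. by move=> xi yi i; rewrite !mxE rpredB. Qed.

(** With the vertices placed at height 1, the lattice points of all dilates
become those of one cone, and affine independence becomes invertibility. *)
Definition homog d (V : 'I_d.+1 -> 'rV[R]_d) : 'M[R]_(d.+1, 1 + d) :=
  row_mx (const_mx 1) (\matrix_i V i).

Lemma mul_homog d (V : 'I_d.+1 -> 'rV[R]_d) (c : 'rV[R]_d.+1) :
  c *m homog V = row_mx (const_mx (\sum_i c 0 i)) (\sum_i c 0 i *: V i).
Proof.
rewrite mul_mx_row; congr row_mx.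
  by apply/rowP => j; rewrite !mxE; apply: eq_bigr => i _; rewrite mxE mulr1.
by rewrite mulmx_sum_row; apply: eq_bigr => i _; rewrite rowK.
Qed.

(** Modulo Z^(d+1) this is the finite abelian group of the simplex; real
representatives make it a lattice, namely Z^(1+d) in the basis of the vertices. *)
Definition Lam d (V : 'I_d.+1 -> 'rV[R]_d) (c : 'rV[R]_d.+1) : Prop :=
  int_row (c *m homog V).

Lemma int_row_mx m n (x : 'rV[R]_m) (y : 'rV[R]_n) :
  int_row (row_mx x y) <-> int_row x /\ int_row y.
Proof.
split=> [h|[hx hy] i].
  split=> i; first by have := h (lshift n i); rewrite row_mxEl.
  by have := h (rshift m i); rewrite row_mxEr.
by case: (splitP i) => j ij; rewrite mxE; case: splitP => // l _.
Qed.

Lemma LamE d (V : 'I_d.+1 -> 'rV[R]_d) (c : 'rV[R]_d.+1) : Lam V c <->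
  \sum_i c 0 i \is a Num.int /\ int_row (\sum_i c 0 i *: V i).
Proof.
rewrite /Lam mul_homog int_row_mx; split=> -[h1 h2]; split=> //.
  by have := h1 ord0; rewrite mxE.
by move=> i; rewrite mxE.
Qed.

Lemma LamB d (V : 'I_d.+1 -> 'rV[R]_d) c c' : Lam V c -> Lam V c' -> Lam V (c - c').
Proof. by rewrite /Lam mulmxBl; exact: int_rowB. Qed.

Section Integral.
Context {d : nat} {V : 'I_d.+1 -> 'rV[R]_d}.
Hypothesis aV : affinely_independent V.
Hypothesis iV : forall i, int_row (V i).

Lemma homog_inv : exists H : 'M[R]_(1 + d, d.+1),
  homog V *m H = 1%:M /\ H *m homog V = 1%:M.
Proof.
have u : (homog V : 'M[R]_(d.+1)) \in unitmx.
  rewrite -row_free_unit; apply: inj_row_free => c.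
  have -> : c *m (homog V : 'M[R]_(d.+1)) = c *m homog V by [].
  rewrite mul_homog => /(congr1 (fun A : 'rV[R]_(1 + d) => (lsubmx A, rsubmx A))).
  rewrite row_mxKl row_mxKr => -[/rowP/(_ 0)]; rewrite !mxE => c1.
  have -> : @rsubmx R 1 1 d 0 = 0 by apply/rowP => i; rewrite !mxE.
  by move=> c2; apply/rowP => i; rewrite (aV c1 c2) mxE.
by exists (invmx (homog V : 'M[R]_(d.+1))); split; [exact: mulmxV|exact: mulVmx].
Qed.

Lemma homog_int i j : homog V i j \is a Num.int.
Proof.
rewrite mxE; case: splitP => l _; first by rewrite mxE.
by rewrite mxE; exact: iV.
Qed.

Lemma LamZ c : int_row c -> Lam V c.
Proof. by move=> ci; apply: int_row_mulmx => // i j; exact: homog_int. Qed.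

Lemma Lam_torsion : exists2 D : nat,
  (0 < D)%N & forall c, Lam V c -> int_row (D%:R *: c).
Proof.
have [A AE] := int_mxP homog_int; have [H [hH Hh]] := homog_inv.
pose B : 'M[int]_d.+1 := A.
have hB : homog V = map_mx intr B :> 'M[R]_(d.+1, d.+1) by exact: AE.
have D0 : \det B != 0.
  have [] := @mulmx1_unit R d.+1 (homog V) H hH; rewrite unitmxE hB det_map_mx.
  by rewrite unitfE intr_eq0.
have dZ (c : 'rV[R]_d.+1) : Lam V c -> int_row ((\det B)%:~R *: c).
  move=> Lc; have -> : (\det B)%:~R *: c = (c *m homog V) *m map_mx intr (\adj B).
    have -> : c *m homog V = c *m (map_mx intr B) by rewrite -hB.
    by rewrite -mulmxA -map_mxM mul_mx_adj map_scalar_mx mul_mx_scalar.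
  by apply: int_row_mulmx => // i j; rewrite mxE intr_int.
exists `|\det B|%N; first by rewrite absz_gt0.
move=> c /dZ cZ i; have := cZ i; rewrite !mxE natr_absz.
by case: (ler0P (\det B)) => _//; rewrite intrN mulNr rpredN.
Qed.

End Integral.

Lemma affine_inj d (V : 'I_d.+1 -> 'rV[R]_d) : affinely_independent V -> injective V.
Proof.
move=> aV i j Vij; apply/eqP; apply: contraT => ij.
have := aV (fun l => (l == i)%:R - (l == j)%:R).
have h (f : 'I_d.+1 -> 'rV[R]_d) l0 : \sum_l (l == l0)%:R *: f l = f l0.
  by rewrite (bigD1 l0)//= eqxx scale1r big1 ?addr0// => l /negPf ->; rewrite scale0r.
have h1 l0 : \sum_(l < d.+1) (l == l0)%:R = 1 :> R.
  by rewrite (bigD1 l0)//= eqxx big1 ?addr0// => l /negPf ->.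
rewrite sumrB !h1 subrr => /(_ erefl).
under eq_bigr do rewrite scalerBl.
rewrite sumrB !h Vij subrr => /(_ erefl i).
by rewrite eqxx (negPf ij)/= subr0 => /eqP; rewrite oner_eq0.
Qed.

(** The vertices are recovered as the extreme points. *)
Lemma hull_inj d (V V' : 'I_d.+1 -> 'rV[R]_d) :
  affinely_independent V -> affinely_independent V' ->
  conv_hull (range V) = conv_hull (range V') ->
  exists s : 'S_d.+1, forall i, V' i = V (s i).
Proof.
move=> aV aV' E.
have /choice[f fE] i : exists j, V' i = V j.
  have := affine_vertex i aV'; rewrite -E => /vertices_hull[j _ <-].
  by exists j.
have fi : injective f by move=> i j ij; apply: (affine_inj aV'); rewrite !fE ij.
by exists (perm fi) => i; rewrite permE fE.
Qed.

Lemma Lam_perm d (V V' : 'I_d.+1 -> 'rV[R]_d) (s : 'S_d.+1) c :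
  (forall i, V' i = V (s i)) -> Lam V' (col_perm s c) <-> Lam V c.
Proof.
move=> E; rewrite !LamE.
have -> : \sum_i col_perm s c 0 i = \sum_i c 0 i.
  rewrite [RHS](reindex_inj (@perm_inj _ s)).
  by apply: eq_bigr => i _; rewrite mxE.
have -> // : \sum_i col_perm s c 0 i *: V' i = \sum_i c 0 i *: V i.
rewrite [RHS](reindex_inj (@perm_inj _ s)).
by apply: eq_bigr => i _; rewrite mxE E.
Qed.

Lemma Lam_affine d (V V' : 'I_d.+1 -> 'rV[R]_d) (U : 'M[int]_d) (w : 'rV[int]_d) c :
  (forall i, V' i = V i *m map_mx intr U + intvec R w) -> Lam V c -> Lam V' c.
Proof.
move=> E; rewrite !LamE => -[c1 c2]; split=> //.
have -> : \sum_i c 0 i *: V' i =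
    (\sum_i c 0 i *: V i) *m map_mx intr U + (\sum_i c 0 i) *: intvec R w.
  rewrite mulmx_suml scaler_suml -big_split/=; apply: eq_bigr => i _.
  by rewrite E scalerDr scalemxAl.
apply: int_rowD; first by apply: int_row_mulmx => // i j; rewrite mxE intr_int.
by move=> i; rewrite !mxE rpredM// intr_int.
Qed.

Lemma Lam_unimod d (V V' : 'I_d.+1 -> 'rV[R]_d) (U : 'M[int]_d) (w : 'rV[int]_d) c :
  U \in unitmx -> (forall i, V' i = V i *m map_mx intr U + intvec R w) ->
  Lam V c <-> Lam V' c.
Proof.
move=> uU E; split; first exact: Lam_affine E.
apply: (@Lam_affine _ _ _ (invmx U) (- w *m invmx U)) => i.
rewrite E mulmxDl -mulmxA -map_mxM mulmxV// map_mx1 mulmx1 /intvec map_mxM.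
by rewrite map_mxN mulNmx addrK.
Qed.

(** Two bases in which Z^(1+d) has the same coordinates differ by an integral
change of basis, which fixes the height. *)
Lemma Lam_eq_unimod d (V V' : 'I_d.+1 -> 'rV[R]_d) :
  affinely_independent V -> affinely_independent V' ->
  (forall c, Lam V c <-> Lam V' c) ->
  exists (U : 'M[int]_d) (w : 'rV[int]_d), U \in unitmx /\
    forall i, V' i = V i *m map_mx intr U + intvec R w.
Proof.
move=> aV aV' LE; have [H [hH Hh]] := homog_inv aV; have [H' [hH' Hh']] := homog_inv aV'.
have step (X Y : 'I_d.+1 -> 'rV[R]_d) (K : 'M[R]_(1 + d, d.+1)) :
    (forall c, Lam X c -> Lam Y c) -> homog X *m K = 1%:M -> K *m homog X = 1%:M ->
    exists (w : 'rV[int]_d) (U : 'M[int]_d),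
      K *m homog Y = map_mx intr (block_mx 1%:M w 0 U).
  move=> XY hK Kh; have [T TE] : exists T : 'M[int]_(1 + d), K *m homog Y = map_mx intr T.
    apply: int_mxP => i j.
    have h : int_row (row i K *m homog Y).
      apply: XY => l; rewrite -row_mul Kh !mxE.
      by case: (_ == _); rewrite ?rpred0 ?rpred1.
    by have := h j; rewrite -row_mul mxE.
  have col0 (Z : 'I_d.+1 -> 'rV[R]_d) : homog Z *m col_mx 1%:M 0 = const_mx 1.
    by rewrite mul_row_col mulmx1 mulmx0 addr0.
  have : K *m homog Y *m col_mx 1%:M 0 = col_mx 1%:M 0.
    by rewrite -mulmxA col0 -(col0 X) mulmxA Kh mul1mx.
  rewrite TE -[T]submxK map_block_mx mul_block_col !mulmx1 !mulmx0 !addr0.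
  move=> /eq_col_mx[e1 e2]; exists (ursubmx T), (drsubmx T).
  by rewrite map_block_mx map_mx1 map_mx0 -e1 -e2.
have [w [U TE]] := step V V' H (fun c => (LE c).1) hH Hh.
have [w' [U' TE']] := step V' V H' (fun c => (LE c).2) hH' Hh'.
exists U, w; split.
  suff : U *m U' = 1%:M by move=> /mulmx1_unit[].
  have : (H *m homog V') *m (H' *m homog V) = 1%:M.
    by rewrite mulmxA -(mulmxA H) hH' mulmx1.
  rewrite TE TE' -map_mxM mulmx_block => /(congr1 (@drsubmx _ 1 d 1 d)).
  rewrite map_block_mx block_mxKdr mul0mx add0r => E.
  apply/matrixP => i j; apply: (@intr_inj R).
  have /matrixP/(_ i j) := E; rewrite !mxE => ->.
  by rewrite eq_rshift; case: (_ == _).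
move=> i; have : homog V *m (H *m homog V') = homog V' by rewrite mulmxA hH mul1mx.
rewrite TE map_block_mx map_mx1 map_mx0 mul_row_block mulmx0 addr0 => /eq_row_mx[_].
move=> /(congr1 (row i)); rewrite rowK => <-.
rewrite raddfD/= !row_mul rowK addrC; congr (_ + _).
rewrite row_const; apply/rowP => j; rewrite mxE big_ord_recl big_ord0 addr0 mxE mul1r.
by rewrite !mxE ord1.
Qed.

Lemma hull_image d e n (V : 'I_n -> 'rV[R]_d) (f : 'rV[R]_d -> 'rV[R]_e) :
  (forall a, weights a -> f (\sum_i a i *: V i) = \sum_i a i *: f (V i)) ->
  [set f x | x in conv_hull (range V)] = conv_hull (range (f \o V)).
Proof.
move=> fE; rewrite !conv_hull_range; apply/seteqP; split.
  by move=> _ [_ [a wa <-] <-]; exists a => //; rewrite fE.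
by move=> _ [a wa <-]; exists (\sum_i a i *: V i); [exists a|rewrite fE].
Qed.

Lemma hull_unimod d n (V : 'I_n -> 'rV[R]_d) (A : 'M[R]_d) (w : 'rV[R]_d) :
  [set x *m A + w | x in conv_hull (range V)] =
  conv_hull (range (fun i => V i *m A + w)).
Proof.
rewrite (hull_image (f := fun x => x *m A + w))// => a [_ a1].
rewrite mulmx_suml -[in LHS](scale1r w) -[in LHS]a1 scaler_suml -big_split/=.
by apply: eq_bigr => i _; rewrite scalerDr scalemxAl.
Qed.

Lemma hull_dilate d n (V : 'I_n -> 'rV[R]_d) (m : nat) :
  dilate m (conv_hull (range V)) = conv_hull (range (fun i => m%:R *: V i)).
Proof.
rewrite /dilate (hull_image (f := fun x => m%:R *: x))// => a _.
by rewrite scaler_sumr; apply: eq_bigr => i _; rewrite !scalerA mulrC.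
Qed.

End Simplex.

(** * The data determines the group up to permutation *)

Section Permutations.
Variable R : realType.

Lemma fiber_perm n (f f' : 'I_n -> nat) :
  (forall a, #|[pred i | f i == a]| = #|[pred i | f' i == a]|) ->
  exists s : 'S_n, forall i, f' i = f (s i).
Proof.
move=> ff; have cnt (h : 'I_n -> nat) a :
    count_mem a [tuple h i | i < n] = #|[pred i | h i == a]|.
  rewrite /= count_map cardE /enum_mem size_filter -enumT.
  rewrite (eq_filter (a2 := predT)) ?filter_predT//.
have : perm_eq [tuple f' i | i < n] [tuple f i | i < n].
  by apply/allP => b _ /=; rewrite !cnt ff.
move=> /tuple_permP[s /val_inj sE]; exists s => i.
have := congr1 (fun t => tnth t i) sE.
by rewrite !tnth_mktuple.
Qed.

Lemma span_col_perm n s (g g' : nat -> 'rV[R]_n) (p : 'S_n) c :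
  (forall b i, (b < s)%N -> g' b.+1 0 i = g b.+1 0 (p i)) ->
  in_span s g' (col_perm p c) <-> in_span s g c.
Proof.
move=> gg; split=> -[t tE]; exists t => i.
  have := tE ((p^-1)%g i); rewrite mxE permKV => /eq_int; apply; congr (_ - _).
  by apply: eq_bigr => b _; rewrite gg// permKV.
rewrite mxE; have := tE (p i) => /eq_int; apply; congr (_ - _).
by apply: eq_bigr => b _; rewrite gg.
Qed.

Lemma realizes_perm k M J n (L L' : 'rV[R]_n -> Prop) (p : 'S_n) :
  (forall c, L' (col_perm p c) <-> L c) -> realizes k M J L -> realizes k M J L'.
Proof.
move=> LL [birth [g [[b0 G] bs Hk LE]]].
exists (birth \o p), (fun a => col_perm p (g a)); split.
- split=> [i|a aJ]; first exact: b0.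
  apply/rowP => i; have /rowP/(_ (p i)) := G a aJ; rewrite !mxE !summxE => ->.
  by congr (_ + _); apply: eq_bigr => b _; rewrite mxE.
- by move=> i; exact: bs.
- move=> a aJ; rewrite -(Hk a aJ) [RHS](reindex_inj (@perm_inj _ p)).
  by apply: eq_bigr => i _; rewrite mxE.
- move=> c; have -> : c = col_perm p (col_perm (p^-1)%g c).
    by rewrite -col_permM mulgV col_perm1.
  rewrite LL LE; apply: iff_sym; apply: span_col_perm => b i _.
  by rewrite mxE.
Qed.

(** Sum over the coordinates the relation of the generator. *)
Lemma birth_card k M J n (birth : 'I_n -> nat) (g : nat -> 'rV[R]_n) a :
  generators M J birth g -> gen_heights k M J g -> (a < size J)%N ->
  (step_ratio M a * (nth 0%N M a * k) =
   (\sum_(b < a) absorbed J a b * nth 0%N M b) * k +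
   #|[pred i | birth i == a.+1]|)%N.
Proof.
move=> G Hk aJ; apply/eqP; rewrite -(eqr_nat R) natrD natrM -(Hk a aJ).
rewrite -(digit_sum_height _ Hk (ltnW aJ)) mulr_sumr -sum1_card natr_sum.
rewrite [X in _ + X]big_mkcond -big_split/=; apply/eqP; apply: eq_bigr => i _.
by rewrite (gen_absorbed i G aJ) inE; case: ifP.
Qed.

Lemma fibers_same k M J n n' (birth : 'I_n -> nat) (birth' : 'I_n' -> nat)
    (g : nat -> 'rV[R]_n) (g' : nat -> 'rV[R]_n') a :
  generators M J birth g -> gen_heights k M J g ->
  (forall i, (birth i <= size J)%N) ->
  generators M J birth' g' -> gen_heights k M J g' ->
  (forall i, (birth' i <= size J)%N) ->
  #|[pred i | birth i == a]| = #|[pred i | birth' i == a]|.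
Proof.
move=> G Hk bs G' Hk' bs'.
have [b0 _] := G; have [b0' _] := G'.
have out m (h : 'I_m -> nat) : (forall i, (0 < h i <= size J)%N) ->
    ~~ (0 < a <= size J)%N -> #|[pred i | h i == a]| = 0%N.
  move=> hb na; apply: eq_card0 => i; rewrite inE; apply/eqP => ia.
  by move: na; rewrite -ia hb.
have [|na] := boolP (0 < a <= size J)%N; last first.
  by rewrite !out// => i; rewrite ?b0 ?b0' ?bs ?bs'.
case: a out => [//|a] _ /= aJ.
have := birth_card G Hk aJ; rewrite (birth_card G' Hk' aJ).
by move=> /addnI.
Qed.

Lemma realizes_dim k M J n n' (L : 'rV[R]_n -> Prop) (L' : 'rV[R]_n' -> Prop) :
  realizes k M J L -> realizes k M J L' -> n = n'.
Proof.
move=> [birth [g [G bs Hk _]]] [birth' [g' [G' bs' Hk' _]]].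
have card m (h : 'I_m -> nat) : (forall i, (h i <= size J)%N) ->
    m = (\sum_(a < (size J).+1) #|[pred i | h i == a]|)%N.
  move=> hb; rewrite -{1}[m]card_ord -sum1_card.
  rewrite (partition_big (fun i => inord (h i) : 'I_(size J).+1) predT)//=.
  apply: eq_bigr => a _; rewrite -sum1_card; apply: eq_bigl => i.
  by rewrite inE -val_eqE/= inordK// ltnS.
rewrite (card _ _ bs) (card _ _ bs'); apply: eq_bigr => a _.
exact: fibers_same G Hk bs G' Hk' bs'.
Qed.

(** Sorted by birth, the coordinates of the two groups match block by block, and
the births determine the generators. *)
Lemma realizes_same k M J n (L L' : 'rV[R]_n -> Prop) :
  filtration_data M J -> realizes k M J L -> realizes k M J L' ->
  exists p : 'S_n, forall c, L' (col_perm p c) <-> L c.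
Proof.
move=> MJ [birth [g [G bs Hk LE]]] [birth' [g' [G' bs' Hk' LE']]].
have [p pE] := fiber_perm (fun a => fibers_same a G Hk bs G' Hk' bs').
exists p => c; rewrite LE' LE; apply: span_col_perm => b.
elim/ltn_ind: b => b IH i bJ.
apply: (mulfI (lt0r_neq0 (ratioR_gt0 R MJ bJ))).
rewrite (genE G' i bJ) (genE G (p i) bJ) pE; congr (_ + _).
by apply: eq_bigr => l _; rewrite IH// (ltn_trans _ bJ).
Qed.

End Permutations.

(** * The Ehrhart series *)

Section Counting.

Lemma card_fset_image (T : finType) (U : choiceType) (f : T -> U) (p : pred T)
    (A : set U) :
  {in p &, injective f} -> (forall y, A y <-> exists2 x, p x & y = f x) ->
  #|` fset_set A| = #|p|.
Proof.
move=> fi AE; pose s := map f (enum p).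
have -> : A = [set` seq_fset tt s].
  have sE y : (y \in seq_fset tt s) = (y \in s) := seq_fsetE tt s y.
  apply/seteqP; split=> y.
    move=> /AE[x px ->]; change (is_true (f x \in seq_fset tt s)); rewrite sE.
    by apply/mapP; exists x => //; rewrite mem_enum.
  move=> ys; have : y \in seq_fset tt s := ys.
  by rewrite sE => /mapP[x]; rewrite mem_enum => px ->; apply/AE; exists x.
rewrite set_fsetK size_seq_fset undup_id ?size_map -?cardE//.
rewrite map_inj_in_uniq ?enum_uniq// => x y.
by rewrite !mem_enum; exact: fi.
Qed.

Lemma one_sub_exp (A : comPzRingType) (y : A) n : exists q, (1 - y) ^+ n = 1 + y * q.
Proof.
elim: n => [|n [q qE]]; first by exists 0; rewrite expr0 mulr0 addr0.
by exists (q - 1 - y * q); rewrite exprS qE; ring.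
Qed.

(** A truncation of 1/(1 - t) that is exact up to the coefficient N. *)
Definition geom (N : nat) : {poly int} := \sum_(j < N.+1) 'X^j.

Lemma geomE N : (1 - 'X) * geom N = 1 - 'X^(N.+1).
Proof.
elim: N => [|N IH]; first by rewrite /geom big_ord1 expr0 mulr1 expr1.
rewrite /geom big_ord_recr/= mulrDr -/(geom N) IH [in X in _ = _ - X]exprS; ring.
Qed.

Lemma geom_exp n N : geom N ^+ n =
  \sum_(t : {ffun 'I_n -> 'I_N.+1}) 'X^(\sum_i t i).
Proof.
rewrite -[in LHS](card_ord n) -prodr_const bigA_distr_bigA/=.
by apply: eq_bigr => t _; rewrite -expr_sum.
Qed.

Lemma coef_geom_exp n N h :
  ('X^h * ((1 - 'X) ^+ n * geom N ^+ n))`_N = (h == N)%:R.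
Proof.
rewrite -exprMn geomE; have [q ->] := one_sub_exp ('X^(N.+1) : {poly int}) n.
rewrite mulrDr mulr1 coefD coefXn mulrCA mulrC coefMXn ltnSn addr0.
by rewrite eq_sym.
Qed.

End Counting.

Section Ehrhart.
Context {R : realType} {d : nat} {V : 'I_d.+1 -> 'rV[R]_d}.
Hypothesis aV : affinely_independent V.
Hypothesis iV : forall i, int_row (V i).
Context {D : nat}.
Hypothesis D0 : (0 < D)%N.
Hypothesis torsD : forall c, Lam V c -> int_row (D%:R *: c).

(** With D the torsion bound, D times a coordinate in the box is a natural number
below D, which makes the elements of the box a finite type. *)
Definition box_of (f : {ffun 'I_d.+1 -> 'I_D}) : 'rV[R]_d.+1 :=
  \row_i ((f i)%:R / D%:R).

Definition box_points : pred {ffun 'I_d.+1 -> 'I_D} :=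
  fun f => `[< Lam V (box_of f) >].

Definition height_of (f : {ffun 'I_d.+1 -> 'I_D}) : nat :=
  ((\sum_i f i) %/ D)%N.

Let DR0 : (0 < D%:R :> R). Proof. by rewrite ltr0n. Qed.

Lemma box_of_box f : unit_box (box_of f).
Proof.
move=> i; rewrite mxE divr_ge0//= ltr_pdivrMr// mul1r ltr_nat.
exact: ltn_ord.
Qed.

Lemma box_of_inj : injective box_of.
Proof.
move=> f f' /rowP E; apply/ffunP => i; apply: val_inj => /=.
have := E i; rewrite !mxE => /(mulIf (invr_neq0 (lt0r_neq0 DR0)))/eqP.
by rewrite eqr_nat => /eqP.
Qed.

Lemma box_of_surj c : Lam V c -> unit_box c ->
  exists2 f, box_points f & c = box_of f.
Proof.
move=> Lc cb; have cD := torsD Lc.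
have /choice[f fE] i : exists f : 'I_D, c 0 i = f%:R / D%:R.
  have := cD i; rewrite mxE => /intrP[z zE].
  have /andP[c0 c1] := cb i.
  have z0 : 0 <= z by rewrite -(ler0z R) -zE mulr_ge0// ltW.
  have zD : (`|z| < D)%N.
    rewrite -(ltr_nat R) natr_absz ger0_norm// -zE -[ltRHS]mulr1.
    by rewrite ltr_pM2l.
  exists (Ordinal zD) => /=; rewrite natr_absz ger0_norm// -zE mulrC mulKf//.
  exact: lt0r_neq0.
have cE : c = box_of [ffun i => f i] by apply/rowP => i; rewrite mxE ffunE fE.
by exists [ffun i => f i] => //; apply/asboolP; rewrite -cE.
Qed.

Lemma height_ofE f : box_points f -> \sum_i box_of f 0 i = (height_of f)%:R.
Proof.
move=> /asboolP/LamE[+ _].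
have -> : \sum_i box_of f 0 i = (\sum_i f i)%:R / D%:R.
  by rewrite natr_sum mulr_suml; apply: eq_bigr => i _; rewrite mxE.
move=> /intrP[z zE]; have : ((\sum_i f i)%:R = z%:~R * D%:R :> R).
  by rewrite -zE divfK// lt0r_neq0.
rewrite /height_of; case: z zE => z zE.
  rewrite -pmulrn -natrM => /eqP; rewrite eqr_nat => /eqP ->.
  by rewrite mulnK// natrM mulfK// lt0r_neq0.
rewrite NegzE mulrNz mulNr => E.
have : 0 <= (\sum_i f i)%:R :> R by [].
rewrite E oppr_ge0 -pmulrn -natrM lern0 muln_eq0/=.
by rewrite gtn_eqF.
Qed.

Definition lattice_pairs (N m : nat) :
    pred ({ffun 'I_d.+1 -> 'I_D} * {ffun 'I_d.+1 -> 'I_N.+1}) :=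
  fun p => box_points p.1 && (height_of p.1 + \sum_i p.2 i == m)%N.

(** Integral and fractional parts of the coefficients: a lattice point of the
cone is a point of the half-open parallelepiped plus a nonnegative integral
combination of the vertices. *)
Lemma ehrhart_pairs N m : (0 < m <= N)%N ->
  ehrhart (conv_hull (range V)) m = #|@lattice_pairs N m|.
Proof.
move=> /andP[m0 mN].
pose c (p : {ffun 'I_d.+1 -> 'I_D} * {ffun 'I_d.+1 -> 'I_N.+1}) : 'rV[R]_d.+1 :=
  \row_i (box_of p.1 0 i + (p.2 i)%:R).
pose pt p := \sum_i c p 0 i *: V i.
have mR : 0 < m%:R :> R by rewrite ltr0n.
have cE p i : c p 0 i = box_of p.1 0 i + (p.2 i)%:R by rewrite mxE.
have c0 p i : 0 <= c p 0 i.
  by rewrite cE addr_ge0//; case/andP: (box_of_box p.1 i).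
have csum p : @lattice_pairs N m p -> \sum_i c p 0 i = m%:R.
  move=> /andP[/height_ofE h /eqP <-]; rewrite natrD -h natr_sum -big_split/=.
  by apply: eq_bigr => i _; rewrite cE.
apply: (@card_fset_image _ _ pt).
- move=> p q pp qq E; have cc : c p = c q.
    apply/rowP => i; apply/eqP; rewrite -subr_eq0; apply/eqP.
    apply: (aV (a := fun i => c p 0 i - c q 0 i)); first by rewrite sumrB !csum// subrr.
    under eq_bigr do rewrite scalerBl.
    by rewrite sumrB -/(pt p) -/(pt q) E subrr.
  have bb i : box_of p.1 0 i = box_of q.1 0 i.
    apply: int_lt1; try exact: box_of_box.
    have /rowP/(_ i) := cc; rewrite !cE => xy.
    rewrite (_ : _ - _ = (q.2 i)%:R - (p.2 i)%:R); last lra.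
    by rewrite rpredB// natr_int.
  have e1 : p.1 = q.1 by apply: box_of_inj; apply/rowP.
  have e2 : p.2 = q.2.
    apply/ffunP => i; apply: val_inj => /=.
    have /rowP/(_ i) := cc; rewrite !cE bb => /addrI/eqP.
    by rewrite eqr_nat => /eqP.
  by case: p q e1 e2 {pp qq E cc bb} => [p1 p2] [q1 q2] /= -> ->.
- move=> y; split.
  + move=> [[x]]; rewrite conv_hull_range => -[a [a0 a1] <-] <- yZ.
    pose b : 'rV[R]_d.+1 := \row_i (m%:R * a i).
    have yE : m%:R *: \sum_i a i *: V i = \sum_i b 0 i *: V i.
      by rewrite scaler_sumr; apply: eq_bigr => i _; rewrite scalerA mxE.
    have bs : \sum_i b 0 i = m%:R.
      by under eq_bigr do rewrite mxE; rewrite -mulr_sumr a1 mulr1.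
    have Lb : Lam V b.
      apply/LamE; rewrite bs natr_int; split=> //.
      by apply/ZlatticeP; rewrite -yE.
    have b0 i : 0 <= b 0 i by rewrite mxE mulr_ge0// ltW.
    have Lf : Lam V (fracpart b).
      exact: (Lam_cong (@LamB _ _ V) (LamZ iV) (fracpart_int_row b) Lb).
    have [f fF fE] := box_of_surj Lf (fracpart_box b).
    have bm i : b 0 i <= m%:R.
      rewrite -bs (bigD1 i)//= lerDl sumr_ge0//.
    have fl0 i : 0 <= Num.floor (b 0 i) by rewrite floor_ge0.
    have tN i : (`|Num.floor (b 0%R i)| < N.+1)%N.
      rewrite ltnS; apply: leq_trans mN.
      rewrite -(ler_nat R) natr_absz ger0_norm//.
      by apply: le_trans (bm i); have /andP[] := floor_itv (b 0 i).
    pose t := [ffun i => Ordinal (tN i)].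
    have cb : c (f, t) = b.
      apply/rowP => i; rewrite cE /= -fE fracpartE ffunE /= natr_absz ger0_norm//.
      by rewrite subrK.
    exists (f, t); last by rewrite /pt cb yE.
    rewrite /lattice_pairs fF /=; apply/eqP/eqP; rewrite -(eqr_nat R) natrD -height_ofE//.
    rewrite natr_sum -big_split/= -bs -cb; apply/eqP; apply: eq_bigr => i _.
    by rewrite cE.
  + move=> [p pp ->]; split.
      exists (\sum_i (c p 0 i / m%:R) *: V i); last first.
        rewrite /pt scaler_sumr; apply: eq_bigr => i _.
        by rewrite scalerA mulrC divfK// lt0r_neq0.
      rewrite conv_hull_range; exists (fun i => c p 0 i / m%:R) => //; split.
        by move=> i; rewrite divr_ge0// ltW.
      by rewrite -mulr_suml csum// divff// lt0r_neq0.
    apply/ZlatticeP; have /andP[/asboolP Lp _] := pp.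
    have : Lam V (c p).
      apply: (Lam_cong (@LamB _ _ V) (LamZ iV) _ Lp) => i.
      by rewrite !mxE opprD addrA subrr sub0r rpredN natr_int.
    by move=> /LamE[].
Qed.

Lemma pairs0 N : #|@lattice_pairs N 0| = 1%N.
Proof.
pose z : {ffun 'I_d.+1 -> 'I_D} * {ffun 'I_d.+1 -> 'I_N.+1} :=
  ([ffun=> Ordinal D0], [ffun=> ord0]).
rewrite (eq_card (B := pred1 z)) ?card1// => -[f t]; rewrite !inE.
apply/idP/eqP => [/andP[/= fF]|->].
  rewrite addn_eq0 sum_nat_eq0 => /andP[/eqP h0 /forallP t0].
  congr (_, _); apply/ffunP => i; rewrite ffunE; apply: val_inj => /=.
    have := height_ofE fF; rewrite h0 => /eqP.
    rewrite psumr_eq0 => [/allP/(_ i)|j _]; last by case/andP: (box_of_box f j).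
    rewrite mem_index_enum mxE => /(_ isT)/=.
    by rewrite mulf_eq0 invr_eq0 (gt_eqF DR0) orbF pnatr_eq0 => /eqP.
  by have := t0 i => /= /eqP.
apply/andP; split=> /=; last first.
  rewrite /height_of big1 => [|i _]; last by rewrite ffunE.
  by rewrite div0n add0n big1// => i _; rewrite ffunE.
apply/asboolP; apply: (LamZ iV) => i.
by rewrite mxE ffunE /= mul0r rpred0.
Qed.

Definition pair_series N : {poly int} :=
  \sum_(f | box_points f) 'X^(height_of f) * geom N ^+ d.+1.

Lemma coef_pair_series N m : (m <= N)%N ->
  (pair_series N)`_m = ehrhart_series (conv_hull (range V)) m.
Proof.
move=> mN; transitivity (#|@lattice_pairs N m|%:Z); last first.
  rewrite /ehrhart_series; case: m mN => [|m] mN /=; first by rewrite pairs0.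
  by rewrite (ehrhart_pairs (N := N)).
rewrite /pair_series coef_sum.
under eq_bigr do rewrite geom_exp mulr_sumr coef_sum.
rewrite pair_big/= -natz -sum1_card natr_sum big_mkcond [RHS]big_mkcond.
apply: eq_bigr => -[f t] _; rewrite /= andbT -exprD coefXn unfold_in /lattice_pairs/=.
by rewrite eq_sym; case: box_points; case: (_ == _).
Qed.

(** The combinations of the vertices contribute the factor 1/(1 - t)^(d+1), so
only the points of the half-open parallelepiped remain. *)
Lemma hstar_coef N :
  \sum_(i < N.+1) ((1 - 'X) ^+ d.+1 : {poly int})`_i *
     ehrhart_series (conv_hull (range V)) (N - i) =
  #|[pred f | box_points f && (height_of f == N)]|%:Z.
Proof.
transitivity (((1 - 'X) ^+ d.+1 * pair_series N)`_N).
  rewrite coefM; apply: eq_bigr => i _; rewrite coef_pair_series//.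
  exact: leq_subr.
rewrite /pair_series mulr_sumr coef_sum.
under eq_bigr do rewrite mulrCA coef_geom_exp.
rewrite -natz -sum1_card natr_sum big_mkcond [RHS]big_mkcond.
apply: eq_bigr => f _; rewrite inE.
by case: box_points; case: (_ == _).
Qed.

End Ehrhart.

(** * The h^*-polynomial and the heights *)

Section HstarHeights.
Context {R : realType} {d : nat} {V : 'I_d.+1 -> 'rV[R]_d}.
Hypothesis aV : affinely_independent V.
Hypothesis iV : forall i, int_row (V i).
Context {k v : nat}.
Hypotheses (k0 : (0 < k)%N) (v0 : (0 < v)%N).

Let h : {poly int} := \sum_(j < v) 'X^(j * k).

Lemma coef_h N : h`_N = [exists j : 'I_v, N == (j * k)%N]%:R.
Proof.
rewrite /h coef_sum; under eq_bigr do rewrite coefXn.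
case: existsP => [[j /eqP ->]|nj].
  rewrite (bigD1 j)//= eqxx big1 ?addr0// => l lj.
  by rewrite eqn_pmul2r// val_eqE eq_sym (negPf lj).
rewrite big1// => j _; case: eqP => // E; case: nj; exists j; exact/eqP.
Qed.

Lemma hstar_heights :
  is_hstar (conv_hull (range V)) h <-> heights k v (Lam V).
Proof.
have [D D0 tD] := Lam_torsion aV iV.
pose F N := [pred f : {ffun 'I_d.+1 -> 'I_D} |
  box_points (V := V) f && (height_of f == N)].
have FE N : \sum_(i < N.+1) ((1 - 'X) ^+ d.+1 : {poly int})`_i *
     ehrhart_series (conv_hull (range V)) (N - i) = #|F N|%:Z.
  exact: hstar_coef.
split=> [[_ hE]|[h1 h2 h3]].
- have card N : #|F N| = [exists j : 'I_v, N == (j * k)%N] :> nat.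
    by apply/eqP; rewrite -eqz_nat -FE -hE coef_h natz.
  split.
  + move=> c Lc cb; have [f bf ->] := box_of_surj D0 tD Lc cb.
    have : (0 < #|F (height_of f)|)%N by apply/card_gt0P; exists f; rewrite inE bf/=.
    rewrite card lt0b => /existsP[j /eqP jE]; exists j; split=> //.
    by rewrite (height_ofE D0 bf) jE.
  + move=> a av; have : (0 < #|F (a * k)%N|)%N.
      by rewrite card lt0b; apply/existsP; exists (Ordinal av).
    move=> /card_gt0P[f]; rewrite inE => /andP[bf /eqP fa].
    exists (box_of (R := R) f); split; [by apply/asboolP|exact: box_of_box|].
    by rewrite (height_ofE D0 bf) fa.
  + move=> c c' Lc cb Lc' cb'.
    have [f bf ->] := box_of_surj D0 tD Lc cb.
    have [f' bf' ->] := box_of_surj D0 tD Lc' cb'.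
    rewrite (height_ofE D0 bf) (height_ofE D0 bf') => /eqP; rewrite eqr_nat => /eqP ff.
    congr box_of; have /card_le1P : (#|F (height_of f)| <= 1)%N by rewrite card leq_b1.
    move=> /(_ f); rewrite inE bf eqxx => /(_ isT f').
    by rewrite !inE bf' ff eqxx => /esym/eqP.
- split.
    have [c [_ cb cE]] := h2 v.-1 ltac:(by rewrite prednK).
    (* The largest height is a sum of d.+1 numbers below 1. *)
    have lt : (v.-1 * k < d.+1)%N.
      rewrite -(ltr_nat R) -cE -[d.+1 in ltRHS]card_ord -sum1_card natr_sum.
      rewrite big_ord_recl [ltRHS]big_ord_recl/= ltr_leD//.
        by case/andP: (cb ord0).
      by apply: ler_sum => i _; apply: ltW; case/andP: (cb (lift ord0 i)).
    apply/leq_sizeP => N dN; rewrite coef_h; case: existsP => // -[j /eqP jE].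
    have : (j * k <= v.-1 * k)%N by rewrite leq_mul2r -ltnS prednK// ltn_ord orbT.
    by move: dN lt; rewrite jE => dN lt le; move: (leq_trans dN le); rewrite leqNgt lt.
  move=> N; rewrite FE coef_h -natz; congr (_%:R).
  case: existsP => [[j /eqP jE]|nj]; last first.
    apply/esym/eq_card0 => f; rewrite inE; apply/negP => /andP[bf /eqP fN].
    have [a [av aE]] := h1 _ (asboolW bf) (box_of_box D0 f).
    apply: nj; exists (Ordinal av); rewrite -fN -(eqr_nat R) -(height_ofE D0 bf).
    by rewrite aE.
  have [c [Lc cb cE]] := h2 j (ltn_ord j).
  have [f bf fE] := box_of_surj D0 tD Lc cb.
  rewrite (eq_card (B := pred1 f)) ?card1// => f'; rewrite !inE.
  apply/andP/eqP => [[bf' /eqP fN]|->].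
    apply: (box_of_inj (R := R) D0); rewrite -fE.
    apply: h3 => //; [exact/asboolP|exact: box_of_box|].
    by rewrite cE (height_ofE D0 bf') fN jE.
  split=> //; rewrite -(eqr_nat R) -(height_ofE D0 bf) -fE cE jE.
  exact: eqxx.
Qed.

End HstarHeights.

(** * Equivalence of bodies and pyramids *)

Section Bodies.
Variable R : realType.

Lemma unimod_refl d (P : set 'rV[R]_d) : unimod_equiv P P.
Proof.
exists 1%:M, 0; split; first exact: unitmx1.
apply/seteqP; split=> [x Px|_ [x Px <-]].
  by exists x => //; rewrite map_mx1 mulmx1 /intvec map_mx0 addr0.
by rewrite map_mx1 mulmx1 /intvec map_mx0 addr0.
Qed.

Lemma unimod_sym d (P Q : set 'rV[R]_d) : unimod_equiv P Q -> unimod_equiv Q P.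
Proof.
move=> [U [w [uU ->]]]; exists (invmx U), (- w *m invmx U); split.
  by rewrite unitmx_inv.
have K (x : 'rV[R]_d) : (x *m map_mx intr U + intvec R w) *m map_mx intr (invmx U) +
    intvec R (- w *m invmx U) = x.
  rewrite mulmxDl -mulmxA -map_mxM mulmxV// map_mx1 mulmx1 /intvec map_mxM.
  by rewrite map_mxN mulNmx addrK.
apply/seteqP; split=> [x Px|_ [_ [x Px <-] <-]]; last by rewrite K.
by exists (x *m map_mx intr U + intvec R w) => //; exists x.
Qed.

Lemma unimod_trans d (P Q S : set 'rV[R]_d) :
  unimod_equiv P Q -> unimod_equiv Q S -> unimod_equiv P S.
Proof.
move=> [U [w [uU ->]]] [U' [w' [uU' ->]]].
exists (U *m U'), (w *m U' + w'); split; first by rewrite unitmx_mul uU.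
have K (x : 'rV[R]_d) : (x *m map_mx intr U + intvec R w) *m map_mx intr U' +
    intvec R w' = x *m map_mx intr (U *m U') + intvec R (w *m U' + w').
  rewrite mulmxDl -mulmxA -map_mxM -addrA; congr (_ + _).
  by rewrite /intvec map_mxD map_mxM.
apply/seteqP; split=> [_ [_ [x Px <-] <-]|_ [x Px <-]].
  by exists x => //; rewrite K.
by exists (x *m map_mx intr U + intvec R w); [exists x|rewrite K].
Qed.

Lemma Body_inj d (P Q : set 'rV[R]_d) : Body P = Body Q -> P = Q.
Proof. exact: (Eqdep_dec.inj_pair2_eq_dec _ (fun x y => decP (x =P y))). Qed.

Lemma body_equivE d (P Q : set 'rV[R]_d) :
  body_equiv (Body P) (Body Q) <-> unimod_equiv P Q.
Proof.
split=> [[d' [P' [Q' [E1 E2]]]]|PQ]; last by exists d, P, Q.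
have E : d = d' := congr1 (@projT1 _ _) E1; subst d'.
by rewrite (Body_inj E1) (Body_inj E2).
Qed.

Lemma body_equiv_dim (B C : body R) : body_equiv B C -> projT1 B = projT1 C.
Proof. by move=> [d [P [Q [-> ->]]]]. Qed.

Lemma body_equiv_sym (B C : body R) : body_equiv B C -> body_equiv C B.
Proof.
by move=> [d [P [Q [-> -> PQ]]]]; exists d, Q, P; split=> //; exact: unimod_sym.
Qed.

Lemma body_equiv_refl (B : body R) : body_equiv B B.
Proof. by case: B => d P; exact/body_equivE/unimod_refl. Qed.

Lemma body_equiv_trans (B C D : body R) :
  body_equiv B C -> body_equiv C D -> body_equiv B D.
Proof.
move=> BC CD; have := body_equiv_dim BC; have := body_equiv_dim CD.
case: B C D BC CD => [d P] [d1 Q] [d2 S] BC CD /= E1 E2; subst d1 d2.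
by move: BC CD => /body_equivE PQ /body_equivE QS; apply/body_equivE/(unimod_trans PQ).
Qed.

Lemma unimod_class_eq (B C : body R) : unimod_class B = unimod_class C <-> body_equiv B C.
Proof.
split=> [E|BC].
  by have : unimod_class C C := body_equiv_refl C; rewrite -E.
apply/seteqP; split=> D; last exact: body_equiv_trans.
by apply: body_equiv_trans; exact: body_equiv_sym.
Qed.

End Bodies.

Section Pyramids.
Variable R : realType.

Lemma range_finite d n (V : 'I_n -> 'rV[R]_d) : finite_set (range V).
Proof. exact/finite_image/finite_finset. Qed.

Lemma lattice_polytope_hull d n (V : 'I_n -> 'rV[R]_d) :
  (forall i, int_row (V i)) -> lattice_polytope (conv_hull (range V)).
Proof.
move=> iV; split; first by exists (range V); split=> //; exact: range_finite.
by move=> x /vertices_hull[i _ <-]; exact/ZlatticeP.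
Qed.

Lemma append_max d (x : 'rV[R]_d) h : append_coord x h 0 ord_max = h.
Proof. by rewrite mxE unlift_none. Qed.

Lemma append_lift d (x : 'rV[R]_d) h j :
  append_coord x h 0 (lift ord_max j) = x 0 j.
Proof. by rewrite mxE liftK. Qed.

Lemma append_eq d (y : 'rV[R]_d.+1) :
  y = append_coord (\row_j y 0 (lift ord_max j)) (y 0 ord_max).
Proof.
apply/rowP => i; case: (unliftP ord_max i) => [j|] ->.
  by rewrite append_lift mxE.
by rewrite append_max.
Qed.

(** The points of last coordinate below 1, together with the apex, form a convex
set. *)
Lemma pyr_last d (Q : set 'rV[R]_d) y : pyr Q y ->
  0 <= y 0 ord_max <= 1 /\ (y 0 ord_max = 1 -> y = append_coord 0 1).
Proof.
move: y; apply: smallest_sub.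
  apply/convexP => x y t [/andP[x0 x1] xa] [/andP[y0 y1] ya] /andP[t0 t1].
  rewrite !mxE; split.
    rewrite addr_ge0 ?mulr_ge0 ?subr_ge0//=.
    have : t * x 0 ord_max <= t * 1 by rewrite ler_wpM2l.
    have : (1 - t) * y 0 ord_max <= (1 - t) * 1 by rewrite ler_wpM2l// subr_ge0.
    by lra.
  have [->|tN0] := eqVneq t 0.
    by rewrite mul0r subr0 mul1r add0r scale0r scale1r add0r.
  have [->|tN1] := eqVneq t 1.
    by rewrite mul1r subrr mul0r addr0 scale0r scale1r addr0.
  move=> E.
  have tt : 0 < t by rewrite lt_neqAle eq_sym tN0.
  have t1' : 0 < 1 - t by rewrite subr_gt0 lt_neqAle tN1.
  have h1 : 0 <= t * (1 - x 0 ord_max) by rewrite mulr_ge0 ?subr_ge0.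
  have h2 : 0 <= (1 - t) * (1 - y 0 ord_max) by rewrite mulr_ge0 ?subr_ge0// ltW.
  have [/eqP e1 /eqP e2] : t * (1 - x 0 ord_max) = 0 /\ (1 - t) * (1 - y 0 ord_max) = 0.
    by split; lra.
  move: e1 e2; rewrite !mulf_eq0 (gt_eqF tt) (gt_eqF t1')/= !subr_eq0.
  by move=> /eqP/esym/xa -> /eqP/esym/ya ->; rewrite -scalerDl addrC subrK scale1r.
move=> _ [[x _ <-]|->]; rewrite append_max ?lexx ?ler01; split=> //.
by move=> /eqP; rewrite eq_sym oner_eq0.
Qed.

Lemma affine_unimod d n (V : 'I_n -> 'rV[R]_d) (U : 'M[int]_d) (w : 'rV[int]_d) :
  U \in unitmx -> affinely_independent V ->
  affinely_independent (fun i => V i *m map_mx intr U + intvec R w).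
Proof.
move=> uU aV a a1; under eq_bigr do rewrite scalerDr scalemxAl.
rewrite big_split/= -mulmx_suml -scaler_suml a1 scale0r addr0 => a2.
apply: (aV _ a1); rewrite -[LHS]mulmx1 -(map_mx1 intr) -(mulmxV uU) map_mxM mulmxA.
by rewrite a2 mul0mx.
Qed.

(** A pyramid over a facet puts every vertex but the apex at height 0, so the
coefficient of the apex is always integral. *)
Lemma pyramid_int_coord d (V : 'I_d.+1 -> 'rV[R]_d) :
  affinely_independent V -> (forall i, int_row (V i)) ->
  lattice_pyramid (Body (conv_hull (range V))) ->
  exists i0, forall c, Lam V c -> c 0 i0 \is a Num.int.
Proof.
move=> aV iV [n [e [Q [_]]]]; rewrite iterS; case: (iter n _ _) => {}e {}Q.
rewrite /Pyr /= => E; have /= ed := body_equiv_dim E; subst d.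
move/body_equivE/unimod_sym: E => [U [w [uU]]]; rewrite hull_unimod.
set X := fun i => _; move=> E.
have XE i : X i = V i *m map_mx intr U + intvec R w by [].
have LE c := Lam_unimod c uU XE.
have iX i : int_row (X i).
  apply: int_rowD; last by move=> l; rewrite mxE intr_int.
  by apply: int_row_mulmx => // a b; rewrite mxE intr_int.
have pX i : pyr Q (X i) by rewrite E; exact: hull_vertex.
have aX := affine_unimod (w := w) uU aV; rewrite -/X in aX.
have x01 i : X i 0 ord_max = 0 \/ X i 0 ord_max = 1.
  have [/andP[h0 h1] _] := pyr_last (pX i).
  have /intrP[z zE] := iX i ord_max.
  rewrite zE; move: h0 h1; rewrite zE ler0z -[1]/(1%:~R) ler_int => h0 h1.
  have [->|->] : z = 0 \/ z = 1 by lia.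
    by left.
  by right.
have [[i0 i1]|none] := pselect (exists i, X i 0 ord_max = 1); last first.
  have [H [_ Hh]] := homog_inv aX.
  have : homog X *m col_mx (0 : 'M[R]_(1, 1)) (delta_mx ord_max 0) = 0.
    rewrite mul_row_col mulmx0 add0r; apply/matrixP => i j.
    rewrite -colE [LHS]mxE [LHS]mxE [RHS]mxE.
    by case: (x01 i) => // i1; case: none; exists i.
  move=> /(congr1 (mulmx H)); rewrite mulmxA Hh mul1mx mulmx0.
  move=> /(congr1 (@dsubmx _ 1 _ _)); rewrite col_mxKd => /matrixP/(_ ord_max 0).
  by rewrite !mxE !eqxx => /eqP; rewrite oner_eq0.
exists i0 => c /LE/LamE[_ /(_ ord_max)].
rewrite summxE (bigD1 i0)//= big1 ?addr0; first by rewrite mxE i1 mulr1.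
move=> i ii0; rewrite mxE; case: (x01 i) => [->|xi1]; first by rewrite mulr0.
have [_ /(_ xi1) e1] := pyr_last (pX i); have [_ /(_ i1) e2] := pyr_last (pX i0).
by case/eqP: ii0; apply: (affine_inj aX); rewrite e1 e2.
Qed.

(** By the Smith normal form of a column, y is a unit times the first column of
a unimodular matrix. *)
Lemma primitive_column e (y : 'cV[int]_e.+1) (a : 'rV[int]_e.+1) :
  a *m y = 1%:M -> exists2 U : 'M[int]_e.+1, U \in unitmx & col ord_max U = y.
Proof.
move=> ay; have [L uL [S uS [ds _ yE]]] := int_Smith_normal_form y.
pose s := ds`_0 * S 0 0.
have yL : y = s *: col 0 L.
  rewrite yE; apply/colP => i; rewrite !mxE big_ord1 !mxE mulrC.
  rewrite big_ord_recl big1 ?addr0 ?mxE => [|l _]; last by rewrite !mxE mulr0.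
  rewrite eqxx mulr1n /s mulrCA [LHS]mulrC; congr (_ * _); exact: mulrC.
have us : s \is a GRing.unit.
  have /matrixP/(_ 0 0) := ay; rewrite yL -scalemxAr !mxE eqxx => /= E.
  by apply/unitrPr; eexists; exact: E.
exists (xcol 0 ord_max (s *: L)).
  rewrite xcolE unitmx_mul unitmx_perm andbT unitmxE detZ unitrM unitrX//.
by rewrite yL; apply/colP => i; rewrite !mxE tpermR.
Qed.

(** An integral coordinate of Lam is an integral affine functional with value 1
at V i0 and 0 at the other vertices. Its linear part is primitive, so it becomes
the last coordinate after a unimodular change of coordinates. *)
Lemma int_coord_pyramid e (V : 'I_e.+2 -> 'rV[R]_e.+1) i0 :
  affinely_independent V -> (forall i, int_row (V i)) ->
  (forall c, Lam V c -> c 0 i0 \is a Num.int) ->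
  lattice_pyramid (Body (conv_hull (range V))).
Proof.
move=> aV iV ci0; have [H [hH Hh]] := homog_inv aV.
have [y yE] : exists y : 'cV[int]_(1 + e.+1), col i0 H = map_mx intr y.
  apply: int_mxP => i j; rewrite mxE.
  have : Lam V (row i H).
    rewrite /Lam -row_mul Hh => l; rewrite !mxE.
    by case: (_ == _); rewrite ?rpred0 ?rpred1.
  by move=> /ci0; rewrite mxE.
pose y0 := y 0 0; pose y1 : 'cV[int]_e.+1 := @dsubmx _ 1 _ _ y.
have hy i : \sum_j V i 0 j * (y1 j 0)%:~R + y0%:~R = (i == i0)%:R.
  have : homog V *m col i0 H = delta_mx i0 0 by rewrite colE mulmxA hH mul1mx.
  rewrite yE -[y]vsubmxK map_col_mx mul_row_col => /colP/(_ i).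
  rewrite !mxE big_ord1 !mxE eqxx andbT mul1r addrC => <-.
  congr (_ + _); last by congr (_%:~R); congr (y _ _); apply: val_inj.
  by apply: eq_bigr => j _; rewrite !mxE.
have [j0 j0i] : exists j0 : 'I_e.+2, j0 != i0.
  by exists (lift i0 0); rewrite eq_sym neq_lift.
have [A AE] : exists A : 'rV[int]_e.+1, V i0 - V j0 = map_mx intr A.
  by apply: int_mxP => i j; rewrite ord1; exact: int_rowB.
have Ay : A *m y1 = 1%:M.
  apply/matrixP => i j; rewrite !ord1; apply: (@intr_inj R); rewrite !mxE eqxx.
  have := hy i0; have := hy j0; rewrite eqxx (negPf j0i)/= => e1 e2.
  rewrite rmorph_sum/= (eq_bigr (fun j =>
    V i0 0 j * (y1 j 0)%:~R - V j0 0 j * (y1 j 0)%:~R)).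
    by rewrite sumrB; lra.
  move=> l _; rewrite intrM -mulrBl; congr (_ * _).
  by have /rowP/(_ l) := AE; rewrite !mxE.
have [U uU Uy] := primitive_column Ay.
pose X0 i := V i *m map_mx intr U.
have X0l i : X0 i 0 ord_max = (i == i0)%:R - y0%:~R.
  rewrite -hy addrK mxE; apply: eq_bigr => j _; congr (_ * _).
  by rewrite mxE; congr (_%:~R); rewrite -Uy mxE.
have [B BE] : exists B : 'rV[int]_e.+1, append_coord 0 1 - X0 i0 = map_mx intr B.
  apply: int_mxP => i j; rewrite ord1; apply: int_rowB.
    move=> l; case: (unliftP ord_max l) => [l'|] ->.
      by rewrite append_lift mxE rpred0.
    by rewrite append_max rpred1.
  by apply: int_row_mulmx => // a b; rewrite mxE intr_int.
(* Translate the apex to (0, ..., 0, 1). *)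
pose X i := V i *m map_mx intr U + intvec R B.
have Xi0 : X i0 = append_coord 0 1 by rewrite /X /intvec -BE addrC subrK.
have Xl i : X i 0 ord_max = (i == i0)%:R.
  have -> : X i = X0 i + (append_coord 0 1 - X0 i0) by rewrite BE.
  have sub : (append_coord 0 1 - X0 i0) 0 ord_max = 1 - X0 i0 0 ord_max.
    by rewrite mxE append_max; congr (_ + _); rewrite [LHS]mxE.
  by rewrite mxE sub !X0l eqxx/=; ring.
have iX i : int_row (X i).
  apply: int_rowD; last by move=> l; rewrite mxE intr_int.
  by apply: int_row_mulmx => // a b; rewrite mxE intr_int.
pose q (j : 'I_e.+1) : 'rV[R]_e := \row_l X (lift i0 j) 0 (lift ord_max l).
have Xq j : X (lift i0 j) = append_coord (q j) 0.
  by rewrite [LHS]append_eq Xl eq_sym (negPf (neq_lift _ _)).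
exists 0%N, e, (conv_hull (range q)); split.
  by apply: lattice_polytope_hull => j l; rewrite mxE; exact: iX.
apply/body_equivE/unimod_sym; exists U, B; split=> //.
rewrite hull_unimod -/X; apply/seteqP; split.
  apply: smallest_sub; first exact: hull_convex.
  move=> _ [[x + <-]|->]; last by rewrite -Xi0; exact: hull_vertex.
  rewrite conv_hull_range => -[a wa <-].
  have -> : append_coord (\sum_i a i *: q i) 0 = \sum_i a i *: X (lift i0 i).
    apply/rowP => i; rewrite summxE; case: (unliftP ord_max i) => [l|] ->.
      rewrite append_lift summxE; apply: eq_bigr => j _.
      by rewrite Xq [in RHS]mxE append_lift mxE.
    by rewrite append_max big1// => j _; rewrite Xq mxE append_max mulr0.
  by apply: convex_comb => [|i|//]; [exact: hull_convex|exact: hull_vertex].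
apply: smallest_sub; first exact: hull_convex.
move=> _ [i _ <-]; apply: sub_gen_smallest.
case: (unliftP i0 i) => [j|] ->; last by right; rewrite Xi0.
by left; exists (q j) => //; exact: hull_vertex.
Qed.

End Pyramids.

(** * Gorenstein simplices *)

Section Reflexive.
Variable R : realType.

Definition dot d (x y : 'rV[R]_d) : R := \sum_i x 0 i * y 0 i.

Lemma dot_suml d n (a : 'I_n -> R) (x : 'I_n -> 'rV[R]_d) y :
  dot (\sum_j a j *: x j) y = \sum_j a j * dot (x j) y.
Proof.
rewrite /dot; under eq_bigr do rewrite summxE mulr_suml.
rewrite exchange_big; apply: eq_bigr => j _; rewrite mulr_sumr.
by apply: eq_bigr => i _; rewrite mxE mulrA.
Qed.

Lemma dot_sumr d n (a : 'I_n -> R) (x : 'I_n -> 'rV[R]_d) y :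
  dot y (\sum_j a j *: x j) = \sum_j a j * dot y (x j).
Proof.
rewrite /dot; under eq_bigr do rewrite summxE mulr_sumr.
rewrite exchange_big; apply: eq_bigr => j _; rewrite mulr_sumr.
by apply: eq_bigr => i _; rewrite mxE mulrCA.
Qed.

Lemma dotBr d (x y z : 'rV[R]_d) : dot z (x - y) = dot z x - dot z y.
Proof.
by rewrite /dot -sumrB; apply: eq_bigr => i _; rewrite !mxE mulrBr.
Qed.

Lemma near_linear_gt d (w : 'rV[R]_d) (m : R) : m < 0 ->
  \forall z \near (0 : 'rV[R]_d), m < dot z w.
Proof.
move=> m0; apply: (@cvgr_gt R _ (nbhs (0 : 'rV[R]_d)) _ (fun z => dot z w) 0 _ m m0).
have E : \sum_(i < d) (0 : 'rV[R]_d) 0 i * w 0 i = 0.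
  by rewrite big1// => i _; rewrite mxE mul0r.
rewrite -[X in _ --> X]E; apply: cvg_big => [|i _]; first exact: add_continuous.
by apply: cvgM; [exact: coord_continuous|exact: cvg_cst].
Qed.

Section Gorenstein.
Context {d : nat} {V : 'I_d.+1 -> 'rV[R]_d}.
Hypothesis aV : affinely_independent V.
Hypothesis iV : forall i, int_row (V i).
Context {u : 'rV[R]_d.+1}.
Hypotheses (Lu : Lam V u) (u0 : forall i, 0 < u 0 i).
Hypothesis umax : forall c, Lam V c -> unit_box c -> forall i, c 0 i <= 1 - u 0 i.

(** Otherwise subtracting a multiple of u leaves a coordinate strictly between
0 and u, whose opposite lies above 1 - u modulo 1. *)
Lemma coord_divides c i : Lam V c -> c 0 i / u 0 i \is a Num.int.
Proof.
move=> Lc; pose q := Num.floor (c 0 i / u 0 i); pose c' := c - q%:~R *: u.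
have Lc' : Lam V c'.
  apply: LamB => //; rewrite /Lam -scalemxAl => j; rewrite mxE rpredM//.
    exact: intr_int.
have := floor_itv (c 0 i / u 0 i); rewrite -/q.
rewrite ler_pdivlMr// ltr_pdivrMr// intrD mulrDl mul1r => /andP[q0 q1].
have E : c' 0 i = c 0 i - q%:~R * u 0 i by rewrite !mxE.
have [c0|c0] := eqVneq (c' 0 i) 0.
  have -> : c 0 i = q%:~R * u 0 i by lra.
  by rewrite mulfK ?lt0r_neq0// intr_int.
have c'0 : 0 < c' 0 i by rewrite lt_neqAle eq_sym c0 E subr_ge0.
have LN : Lam V (fracpart (- c')).
  have L0 : Lam V 0 by apply: (LamZ iV) => j; rewrite mxE.
  apply: (Lam_frac (@LamB _ _ V) (LamZ iV)).
  by have := LamB L0 Lc'; rewrite sub0r.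
have Lf := Lam_frac (@LamB _ _ V) (LamZ iV) Lc'.
have := umax Lf (fracpart_box _) i; have := umax LN (fracpart_box _) i.
have /andP[f0 f1] := fracpart_box c' i; have /andP[n0 n1] := fracpart_box (- c') i.
have ui := u0 i.
have u1 : u 0 i <= 1 by have := umax Lf (fracpart_box _) i; lra.
have -> : fracpart (- c') 0 i = 1 - c' 0 i.
  apply: int_lt1; last by lra.
    rewrite fracpartE [(- c') 0 i]mxE; set fl := (_%:~R : R).
    rewrite (_ : _ - _ = - (fl + 1)); last by ring.
    by rewrite rpredN rpredD ?rpred1 ?intr_int.
  exact: fracpart_box.
by lra.
Qed.

(** In the dilate by the height r of u, the lattice point p = sum u_i V_i is at
distance 1 from every facet. After translating p to the origin, the facet
opposite to vertex i is the set where dot z (y i) = 1, with y i integral by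
coord_divides, so that the y i are the vertices of the dual. *)
Lemma gorenstein_of_min : gorenstein (conv_hull (range V)).
Proof.
have [H [hH Hh]] := homog_inv aV.
have [us uV] : \sum_i u 0 i \is a Num.int /\ int_row (\sum_i u 0 i *: V i).
  exact/LamE.
have [r rE] : exists r : nat, \sum_i u 0 i = r%:R.
  apply/natrP; rewrite natrEint us sumr_ge0// => i _; exact: ltW.
have r0 : 0 < r%:R :> R.
  by rewrite -rE (bigD1 ord0)//= ltr_pwDl// sumr_ge0// => i _; exact: ltW.
set p := \sum_i u 0 i *: V i in uV.
pose q i := r%:R *: V i - p.
have iq i : int_row (q i).
  apply: int_rowB => // j; rewrite mxE rpredM ?natr_int//; exact: iV.
pose K i : 'rV[R]_d := (col i (@dsubmx _ 1 d _ H))^T.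
pose y i := - (u 0 i)^-1 *: K i.
have iy i : int_row (y i).
  move=> j; rewrite !mxE mulNr rpredN mulrC.
  have Lr : Lam V (row (rshift 1 j) H).
    rewrite /Lam -row_mul Hh => l; rewrite !mxE.
    by case: (_ == _); rewrite ?rpred0 ?rpred1.
  by have := coord_divides i Lr; rewrite mxE.
have dotK (z : 'rV[R]_d) i : dot z (K i) = (row_mx 0 z *m H) 0 i.
  rewrite -[H]vsubmxK mul_row_col mul0mx add0r mxE.
  by apply: eq_bigr => l _; rewrite !mxE.
have coordV (c : 'rV[R]_d.+1) i : (c *m homog V *m H) 0 i = c 0 i.
  by rewrite -mulmxA hH mulmx1.
have qK j i : dot (q j) (K i) = r%:R * (i == j)%:R - u 0 i.
  rewrite dotK; have -> : row_mx 0 (q j) = (r%:R *: delta_mx 0 j - u) *m homog V.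
    rewrite mul_homog; congr row_mx.
      apply/rowP => l; rewrite !mxE; under eq_bigr do rewrite !mxE eqxx/=.
      rewrite sumrB rE -mulr_sumr (bigD1 j)//= eqxx.
      by rewrite big1 ?addr0 ?mulr1 ?subrr// => a /negPf ->.
    rewrite /q; under eq_bigr do rewrite !mxE eqxx/= scalerBl.
    rewrite sumrB -/p (bigD1 j)//= eqxx mulr1 big1 ?addr0// => a /negPf ->.
    by rewrite mulr0 scale0r.
  by rewrite coordV !mxE eqxx.
have qy j i : dot (q j) (y i) = 1 - r%:R * (i == j)%:R / u 0 i.
  have -> : dot (q j) (y i) = - (u 0 i)^-1 * dot (q j) (K i).
    by rewrite /dot mulr_sumr; apply: eq_bigr => l _; rewrite [y i 0 l]mxE mulrCA.
  have ui := lt0r_neq0 (u0 i).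
  by rewrite qK; field.
have uq : \sum_i u 0 i *: q i = 0.
  rewrite /q; under eq_bigr do rewrite scalerBr.
  rewrite sumrB -scaler_suml rE; apply/eqP; rewrite subr_eq0; apply/eqP.
  by rewrite /p scaler_sumr; apply: eq_bigr => i _; rewrite !scalerA mulrC.
have sep (e : 'rV[R]_d) : (forall j, dot (q j) e = 0) -> e = 0.
  move=> qe; have Ve (c : 'rV[R]_d.+1) :
      \sum_i c 0 i = 0 -> dot (\sum_i c 0 i *: V i) e = 0.
    move=> c0; have -> : \sum_i c 0 i *: V i = \sum_i (c 0 i / r%:R) *: q i.
      rewrite /q; under [RHS]eq_bigr do rewrite scalerBr scalerA.
      rewrite sumrB -scaler_suml -mulr_suml c0 mul0r scale0r subr0.
      by apply: eq_bigr => i _; rewrite divfK// lt0r_neq0.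
    by rewrite dot_suml big1// => j _; rewrite qe mulr0.
  apply/rowP => l; rewrite mxE.
  pose el : 'rV[R]_d := delta_mx 0 l.
  have := Ve (row_mx 0 el *m H).
  have : row_mx 0 el *m H *m homog V = row_mx 0 el.
    by rewrite -mulmxA Hh mulmx1.
  rewrite mul_homog => /eq_row_mx[/rowP/(_ 0)]; rewrite !mxE => c0 -> /(_ c0) <-.
  rewrite /dot (bigD1 l)//= mxE !eqxx mul1r big1 ?addr0// => i /negPf il.
  by rewrite mxE il andbF mul0r.
have QE : conv_hull (range q) = [set x + - p | x in dilate r (conv_hull (range V))].
  rewrite hull_dilate (hull_image (f := fun x => x + - p))// => a [_ a1].
  under [RHS]eq_bigr do rewrite scalerDr.
  by rewrite big_split/= -scaler_suml a1 scale1r.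
exists r, (conv_hull (range q)); split.
- by rewrite -(ltr_nat R).
- split; first exact: lattice_polytope_hull.
  + have near_all : \forall z \near (0 : 'rV[R]_d), forall i, - u 0 i < dot z (K i).
      apply: (@filter_forall _ _ (fun i z => is_true (- u 0 i < dot z (K i)))
        (nbhs (0 : 'rV[R]_d)) _) => i.
      by apply: near_linear_gt; rewrite oppr_lt0.
    have : nbhs (0 : 'rV[R]_d) (conv_hull (range q)); last by [].
    apply: (filterS _ near_all) => z zK; rewrite conv_hull_range.
    pose c : 'rV[R]_d.+1 := row_mx 0 z *m H.
    have cV : c *m homog V = row_mx 0 z by rewrite -mulmxA Hh mulmx1.
    move: (cV); rewrite mul_homog => /eq_row_mx[/rowP/(_ 0)]; rewrite !mxE => c0 cz.
    exists (fun i => (u 0 i + c 0 i) / r%:R).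
      split=> [i|]; last by rewrite -mulr_suml big_split/= rE c0 addr0 divff ?lt0r_neq0.
      rewrite divr_ge0// ?ltW// -dotK; have := zK i; lra.
    rewrite /q; under eq_bigr do rewrite scalerBr scalerA divfK ?lt0r_neq0// scalerDl.
    rewrite sumrB big_split/= -/p cz -scaler_suml -mulr_suml big_split/= rE c0 addr0.
    by rewrite divff ?lt0r_neq0// scale1r addrAC subrr add0r.
  + have -> : dual_polytope (conv_hull (range q)) = conv_hull (range y).
      rewrite [conv_hull (range y)]conv_hull_range.
      apply/seteqP; split=> [e eQ|_ [a [a0 a1] <-] x].
        have s0 j : 0 <= 1 - dot (q j) e.
          by rewrite subr_ge0; apply: eQ; exact: hull_vertex.
        pose t j := (1 - dot (q j) e) * u 0 j / r%:R.
        have t1 : \sum_j t j = 1.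
          rewrite -mulr_suml; under eq_bigr do rewrite mulrBl mul1r mulrC.
          rewrite sumrB rE -dot_suml uq [dot 0 e]big1 ?subr0 ?divff ?lt0r_neq0//.
          by move=> l _; rewrite mxE mul0r.
        exists t; first by split=> // j; rewrite divr_ge0 ?mulr_ge0// ltW.
        apply/eqP; rewrite -subr_eq0; apply/eqP/sep => j.
        rewrite dotBr dot_sumr; under eq_bigr do rewrite qy mulrBr mulr1.
        rewrite sumrB t1 (bigD1 j)//= eqxx big1 ?addr0 => [|l /negPf ->]; last first.
          by rewrite mulr0 mul0r mulr0.
        rewrite /t mulr1; have uj := lt0r_neq0 (u0 j); have rn := lt0r_neq0 r0.
        by rewrite -/(dot (q j) e); field; rewrite uj rn.
      rewrite conv_hull_range => -[b [b0 b1] <-].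
      rewrite -/(dot _ _) dot_suml -[leRHS]b1; apply: ler_sum => j _.
      rewrite -[leRHS]mulr1 ler_wpM2l// dot_sumr -[leRHS]a1; apply: ler_sum => i _.
      rewrite -[leRHS]mulr1 ler_wpM2l// qy gerBl.
      by apply: divr_ge0; [apply: mulr_ge0 => //; exact: ltW|exact: ltW].
    exact: lattice_polytope_hull.
- have [w wE] : exists w : 'rV[int]_d, - p = map_mx intr w.
    by apply: int_mxP => i j; rewrite ord1 mxE rpredN.
  exists 1%:M, w; split; first exact: unitmx1.
  rewrite QE; congr image; apply/funext => x.
  by rewrite map_mx1 mulmx1 /intvec -wE.
Qed.

End Gorenstein.
End Reflexive.

(** * A simplex for given chain data *)

Section Construction.
Variable R : realType.

(** As many fresh coordinates as generator a.+1 needs to have height M_a k; the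
subtracted sum is the part that comes from the absorbed generators. *)
Definition block_size k M J a : nat :=
  (k * nth 0%N M a.+1 - (\sum_(b < a) absorbed J a b * nth 0%N M b) * k)%N.

Lemma block_sizeE k M J a : filtration_data M J -> (a < size J)%N ->
  ((\sum_(b < a) absorbed J a b * nth 0%N M b) * k + block_size k M J a =
   k * nth 0%N M a.+1)%N.
Proof.
move=> MJ aJ; rewrite subnKC// mulnC leq_mul2l ltnW ?orbT//.
apply: ltn_trans (chain_lt MJ aJ).
exact: (digits_lt MJ (ltnW aJ) (absorbed_digits MJ aJ)).
Qed.

Lemma block_size_gt0 k M J a : (0 < k)%N -> filtration_data M J -> (a < size J)%N ->
  (0 < block_size k M J a)%N.
Proof.
move=> k0 MJ aJ; rewrite subn_gt0 mulnC ltn_pmul2l//.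
apply: ltn_trans (chain_lt MJ aJ).
exact: (digits_lt MJ (ltnW aJ) (absorbed_digits MJ aJ)).
Qed.

(** A table up to a, since the recursion for generator a.+1 uses all the earlier
ones. *)
Fixpoint gens_upto n M J (birth : 'I_n -> nat) (a : nat) : nat -> 'rV[R]_n :=
  if a is a'.+1 then fun x =>
    if x == a'.+1 then (step_ratio M a')%:R^-1 *:
      (\sum_(b < a' | b.+1 \in nth fset0 J a') gens_upto M J birth a' b.+1 +
       born R birth a'.+1)
    else gens_upto M J birth a' x
  else fun=> 0.

Lemma generators_exist n M J (birth : 'I_n -> nat) : filtration_data M J ->
  (forall i, (0 < birth i)%N) -> exists g : nat -> 'rV[R]_n, generators M J birth g.
Proof.
move=> MJ b0; pose g x := gens_upto M J birth x x.
have gE a x : (x <= a)%N -> gens_upto M J birth a x = g x.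
  elim: a => [|a IH]; first by rewrite leqn0 => /eqP ->.
  rewrite leq_eqVlt => /orP[/eqP ->//|]; rewrite ltnS => xa /=.
  by rewrite ltn_eqF// IH.
exists g; split=> // a aJ; rewrite /g /= eqxx scalerA divff ?scale1r; last first.
  exact: lt0r_neq0 (ratioR_gt0 R MJ aJ).
by congr (_ + _); apply: eq_bigr => b _; rewrite gE.
Qed.

Lemma births_exist k M J : (0 < k)%N -> filtration_data M J ->
  exists n (birth : 'I_n -> nat), (forall i, (0 < birth i <= size J)%N) /\
  forall a, (a < size J)%N -> #|[pred i | birth i == a.+1]| = block_size k M J a.
Proof.
move=> k0 MJ.
pose bl := flatten [seq nseq (block_size k M J a) a.+1 | a <- iota 0 (size J)].
have mem_bl x : x \in bl -> (0 < x <= size J)%N.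
  move=> /flattenP[l /mapP[a]]; rewrite mem_iota add0n => /andP[_ aJ] ->.
  by rewrite mem_nseq => /andP[_ /eqP ->].
have cnt a s : count_mem a.+1 (flatten [seq nseq (block_size k M J b) b.+1 | b <- s]) =
    (\sum_(b <- s) (b == a) * block_size k M J b)%N.
  elim: s => [|b s IH] /=; first by rewrite big_nil.
  by rewrite count_cat IH big_cons count_nseq/= eqSS.
exists (size bl), (fun i => nth 0%N bl i); split=> [i|a aJ].
  by apply: mem_bl; rewrite mem_nth.
rewrite -sum1_card -[RHS](_ : count_mem a.+1 bl = _).
  rewrite -sum1_count (big_nth 0%N) big_mkord.
  by apply: eq_bigl => i.
rewrite cnt (bigD1_seq a) ?iota_uniq ?mem_iota//= eqxx mul1n big1 ?addn0//.
by move=> b /negPf ->.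
Qed.

Lemma gen_heights_of k n M J (birth : 'I_n -> nat) (g : nat -> 'rV[R]_n) :
  filtration_data M J -> generators M J birth g ->
  (forall a, (a < size J)%N -> #|[pred i | birth i == a.+1]| = block_size k M J a) ->
  gen_heights k M J g.
Proof.
move=> MJ G bc; elim/ltn_ind => a IH aJ.
apply: (mulfI (lt0r_neq0 (ratioR_gt0 R MJ aJ))).
rewrite mulr_sumr; under eq_bigr do rewrite (genE G _ aJ).
rewrite big_split/= exchange_big/=.
have -> : \sum_(b < a | b.+1 \in nth fset0 J a) \sum_i g b.+1 0 i =
    ((\sum_(b < a) absorbed J a b * nth 0%N M b) * k)%:R.
  rewrite big_mkcond big_distrl natr_sum; apply: eq_bigr => b _.
  rewrite /absorbed; case: (_ \in _); last by rewrite !mul0n.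
  by rewrite mul1n IH// (ltn_trans _ aJ).
have -> : \sum_i (birth i == a.+1)%:R = (block_size k M J a)%:R :> R.
  rewrite -bc// -sum1_card natr_sum [RHS]big_mkcond; apply: eq_bigr => i _.
  by rewrite inE; case: ifP.
by rewrite -natrD block_sizeE// (chain_step MJ aJ) -natrM; congr (_%:R); lia.
Qed.

Section Basis.
Context {d : nat} {M : seq nat} {J : seq {fset nat}} {birth : 'I_d.+1 -> nat}.
Context {g : nat -> 'rV[R]_d.+1}.
Hypothesis MJ : filtration_data M J.
Hypothesis G : generators M J birth g.
Hypothesis bJ : forall i, (birth i <= size J)%N.
Context {k : nat}.
Hypothesis Hk : gen_heights k M J g.
Context {rep : nat -> 'I_d.+1} {i0 : 'I_d.+1}.
Hypothesis repP : forall a, (a < size J)%N -> birth (rep a.+1) = a.+1.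
Hypothesis i0P : i0 != rep (birth i0).

(** The unit vector of one coordinate of each block gives way to the generator of
the block, whose relation expresses that unit vector. *)
Definition basis : 'M[R]_d.+1 :=
  \matrix_(i < d.+1) (if i == rep (birth i) then g (birth i) else delta_mx 0 i).

Let zspan (c : 'rV[R]_d.+1) := exists z : 'rV[R]_d.+1, int_row z /\ c = z *m basis.

Let zspanB c c' : zspan c -> zspan c' -> zspan (c - c').
Proof.
move=> [z [zi ->]] [z' [zi' ->]]; exists (z - z'); split; last by rewrite mulmxBl.
exact: int_rowB.
Qed.

Let zspan0 : zspan 0.
Proof. by exists 0; split; [move=> i; rewrite mxE rpred0|rewrite mul0mx]. Qed.

Let zspanD c c' : zspan c -> zspan c' -> zspan (c + c').
Proof. by move=> h h'; have := zspanB h (zspanB zspan0 h'); rewrite sub0r opprK. Qed.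

Let zspanZ (x : R) c : x \is a Num.int -> zspan c -> zspan (x *: c).
Proof.
move=> xi [z [zi ->]]; exists (x *: z); split; last by rewrite scalemxAl.
by move=> i; rewrite mxE rpredM.
Qed.

Let zspan_sum (I : finType) (P : pred I) (F : I -> 'rV[R]_d.+1) :
  (forall i, P i -> zspan (F i)) -> zspan (\sum_(i | P i) F i).
Proof. by move=> h; apply: big_ind => //; exact: zspanD. Qed.

Let zspan_row i : zspan (row i basis).
Proof.
exists (delta_mx 0 i); split; last by rewrite rowE.
by move=> j; rewrite mxE; case: (_ && _); rewrite ?rpred0 ?rpred1.
Qed.

Let zspan_gen a : (a < size J)%N -> zspan (g a.+1).
Proof.
move=> aJ; have := zspan_row (rep a.+1).
by rewrite rowK repP// eqxx.
Qed.

Let zspan_delta i : zspan (delta_mx 0 i).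
Proof.
have nonrep l : l != rep (birth l) -> zspan (delta_mx 0 l).
  by move=> /negPf lr; have := zspan_row l; rewrite rowK lr.
have [ir|] := eqVneq i (rep (birth i)); last exact: nonrep.
have b0 : (0 < birth i)%N by case: G.
have bE : birth i = (birth i).-1.+1 by rewrite prednK.
have aJ : ((birth i).-1 < size J)%N by rewrite -bE.
set a := (birth i).-1 in bE aJ.
have E : delta_mx 0 i = (step_ratio M a)%:R *: g a.+1 -
    \sum_(b < a | b.+1 \in nth fset0 J a) g b.+1 -
    \sum_(l | (birth l == a.+1) && (l != i)) delta_mx 0 l.
  have [_ /(_ a aJ) ->] := G; rewrite [X in X - _ - _]addrC addrK.
  apply/rowP => j; rewrite !mxE summxE.
  under eq_bigr do rewrite mxE eqxx/=.
  have [->|ji] := eqVneq j i.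
    rewrite bE !eqxx big1 ?subr0// => l /andP[_ /negPf li].
    by rewrite eq_sym li.
  rewrite andbF; case: (eqVneq (birth j) a.+1) => jb.
    rewrite (bigD1 j)/=; last by rewrite jb eqxx ji.
    rewrite eqxx big1 ?addr0 ?subrr// => l /andP[_ /negPf lj].
    by rewrite eq_sym lj.
  rewrite big1 ?subr0// => l /andP[lb _]; case: eqP => // jl.
  by move: jb; rewrite jl lb.
rewrite E; apply: zspanB; first apply: zspanB.
- by apply: zspanZ; [exact: natr_int|exact: zspan_gen].
- by apply: zspan_sum => b _; apply: zspan_gen; exact: ltn_trans aJ.
- apply: zspan_sum => l /andP[/eqP lb li]; apply: nonrep.
  by rewrite lb -bE -ir.
Qed.

Lemma zspanP c : zspan c <-> in_span (size J) g c.
Proof.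
split=> [[z [zi ->]]|[t tE]].
  rewrite mulmx_sum_row; apply: big_ind; [exact: span0|exact: span_add|move=> i _].
  apply: span_scale => //; rewrite rowK; case: eqP => _.
    have b0 : (0 < birth i)%N by case: G.
    by rewrite -(prednK b0); apply: span_gen; rewrite prednK.
  by apply: span_int => j; rewrite mxE; case: (_ && _); rewrite ?rpred0 ?rpred1.
pose w : 'rV[R]_d.+1 := c - \sum_(b < size J) (t b)%:~R *: g b.+1.
have wi : int_row w.
  move=> i; rewrite !mxE summxE; have := tE i => /eq_int; apply.
  by congr (_ - _); apply: eq_bigr => b _; rewrite mxE.
have -> : c = \sum_(b < size J) (t b)%:~R *: g b.+1 + \sum_i w 0 i *: delta_mx 0 i.
  by rewrite -row_sum_delta /w addrC subrK.
apply: zspanD; apply: zspan_sum => i _; apply: zspanZ => //.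
exact: zspan_gen.
Qed.

Lemma basis_inv : exists W : 'M[R]_d.+1,
  [/\ W *m basis = 1%:M, basis *m W = 1%:M & forall i j, W i j \is a Num.int].
Proof.
have /choice[w wP] i := zspan_delta i.
pose W : 'M[R]_d.+1 := \matrix_i w i.
have WB : W *m basis = 1%:M.
  apply/row_matrixP => i; rewrite row_mul rowK row1.
  by case: (wP i) => _ <-.
exists W; split=> // [|i j]; first exact: mulmx1C.
by rewrite mxE; case: (wP i).
Qed.

Lemma basis_sum i : \sum_j basis i j \is a Num.int.
Proof.
under eq_bigr do rewrite mxE.
have b0 : (0 < birth i)%N by case: G.
case: eqP => _.
  by rewrite -(prednK b0) Hk ?natr_int// prednK.
by rewrite rpred_sum// => j _; rewrite mxE; case: (_ && _); rewrite ?rpred0 ?rpred1.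
Qed.

(** The vertices are the unit vectors read in the basis. The basis vector of i0
has coordinate sum 1, so its coefficient is recovered from the height and can be
dropped. *)
Lemma simplex_of_basis : exists V : 'I_d.+1 -> 'rV[R]_d,
  [/\ affinely_independent V, forall i, int_row (V i) &
      forall c, Lam V c <-> in_span (size J) g c].
Proof.
have [W [WB BW Wi]] := basis_inv.
pose V i : 'rV[R]_d := \row_l W i (lift i0 l).
have VW (c : 'rV[R]_d.+1) l : (\sum_i c 0 i *: V i) 0 l = (c *m W) 0 (lift i0 l).
  by rewrite summxE mxE; apply: eq_bigr => i _; rewrite !mxE.
pose s i := \sum_j basis i j.
have s0 : s i0 = 1.
  rewrite /s; under eq_bigr do rewrite mxE (negPf i0P).
  by rewrite (bigD1 i0)//= mxE !eqxx big1 ?addr0// => j /negPf ji; rewrite mxE ji andbF.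
have cs (c : 'rV[R]_d.+1) : \sum_i c 0 i =
    (c *m W) 0 i0 + \sum_(l < d) (c *m W) 0 (lift i0 l) * s (lift i0 l).
  have E : \sum_i c 0 i = \sum_i (c *m W) 0 i * s i.
    rewrite -{1}[c]mulmx1 -WB mulmxA /s; under eq_bigr do rewrite mxE.
    by rewrite exchange_big; apply: eq_bigr => i _; rewrite mulr_sumr.
  by rewrite E (bigD1_ord i0)//= s0 mulr1.
have back (c : 'rV[R]_d.+1) : c = (c *m W) *m basis by rewrite -mulmxA WB mulmx1.
exists V; split.
- move=> a a1 a2; pose c : 'rV[R]_d.+1 := \row_i a i.
  have aE i : c 0 i = a i by rewrite mxE.
  have cl l : (c *m W) 0 (lift i0 l) = 0.
    rewrite -VW; under eq_bigr do rewrite aE.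
    by rewrite a2 mxE.
  have c0 : (c *m W) 0 i0 = 0.
    have := cs c; under eq_bigr do rewrite aE.
    by rewrite a1 big1 ?addr0// => l _; rewrite cl mul0r.
  have cW : c *m W = 0.
    apply/rowP => i; rewrite [RHS]mxE; by case: (unliftP i0 i) => [l|] ->.
  by move=> i; rewrite -aE [c]back cW mul0mx mxE.
- by move=> i l; rewrite mxE.
- move=> c; rewrite LamE -zspanP; split=> [[c1 c2]|[z [zi ->]]].
    exists (c *m W); split; last exact: back.
    have cl l : (c *m W) 0 (lift i0 l) \is a Num.int by rewrite -VW.
    move=> i; case: (unliftP i0 i) => [l|] -> //.
    rewrite (_ : (c *m W) 0 i0 = \sum_i c 0 i -
        \sum_(l < d) (c *m W) 0 (lift i0 l) * s (lift i0 l)).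
      by rewrite rpredB// rpred_sum// => l _; rewrite rpredM// basis_sum.
    by rewrite cs addrK.
  have zW : z *m basis *m W = z by rewrite -mulmxA BW mulmx1.
  split; last by move=> l; rewrite VW zW.
  by rewrite cs zW rpredD// rpred_sum// => l _; rewrite rpredM// basis_sum.
Qed.

End Basis.
End Construction.

(** * The bijection *)

Section Assembly.
Variable R : realType.

Lemma chain_dataP v M J : (2 <= v)%N ->
  chain_data v (M, J) <-> filtration_data M J /\ nth 0%N M (size J) = v.
Proof.
move=> v2; split=> [[/= [M1 Mh Ml Ms] MJ JS]|[MJ Mv]].
  have Mv : nth 0%N M (size J) = v by rewrite -Ml -nth_last MJ.
  have st a : (a < size J)%N ->
      (nth 0%N M a %| nth 0%N M a.+1)%N && (nth 0%N M a != nth 0%N M a.+1).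
    by move=> aJ; move/sortedP : Ms => /(_ 0%N a); apply; rewrite MJ ltnS.
  (* The members of the chain divide v, hence are positive. *)
  have pos b : (b <= size J)%N -> (0 < nth 0%N M (size J - b))%N.
    elim: b => [_|b IH bJ]; first by rewrite subn0 Mv; exact: ltnW.
    have lt : (size J - b.+1 < size J)%N by lia.
    have /andP[dv _] := st _ lt; move: dv.
    have -> : (size J - b.+1).+1 = (size J - b)%N by lia.
    by move/dvdn_gt0; apply; apply: IH; exact: ltnW.
  split=> //; split=> // a aJ.
  have /andP[dv ne] := st a aJ; rewrite dv ltn_neqAle ne/= dvdn_leq//.
  by have := pos (size J - a.+1)%N (leq_subr _ _); rewrite subKn.
have [sM M0 st Jsub] := MJ.
have J0 : (0 < size J)%N by case: (size J) Mv M0 => // ->; lia.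
split=> //=; split=> //.
- by rewrite sM.
- by rewrite -nth_last sM.
- apply/(sortedP 0%N) => a; rewrite sM ltnS => aJ.
  by have /andP[-> lt] := st a aJ; rewrite neq_ltn lt.
Qed.

Lemma data_simplex k M J : (0 < k)%N -> (0 < size J)%N -> filtration_data M J ->
  exists d (V : 'I_d.+1 -> 'rV[R]_d), [/\ affinely_independent V,
    forall i, int_row (V i) & realizes k M J (Lam V)].
Proof.
move=> k0 J0 MJ; have [n [birth [b01 bc]]] := births_exist k0 MJ.
have b0 i : (0 < birth i)%N by case/andP: (b01 i).
have bJ i : (birth i <= size J)%N by case/andP: (b01 i).
(* The first block has k M_1 >= 2 coordinates; one of them is left when its
   representative gives way to the generator. *)
have [i1 [i2 [/eqP b1 /eqP b2 i12]]] : exists i1 i2,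
    [/\ birth i1 == 1%N, birth i2 == 1%N & i1 != i2].
  have : (1 < #|[pred i | birth i == 1%N]|)%N.
    rewrite bc// /block_size big_ord0 mul0n subn0.
    have := chain_lt MJ J0; case: MJ => _ -> _ _ lt.
    by apply: leq_trans lt _; exact: leq_pmull.
  by move=> /card_gt1P[x [y [xb yb xy]]]; exists x, y.
case: n birth b01 bc b0 bJ i1 i2 b1 b2 i12 => [|d] birth b01 bc b0 bJ i1 i2 b1 b2 i12.
  by case: i1 b1 i12.
have [g G] := generators_exist R MJ b0.
have Hk := gen_heights_of MJ G bc.
have /choice[r rP] a : exists i, (a < size J)%N -> birth i = a.+1.
  have [aJ|aJ] := ltnP a (size J); last by exists ord0.
  have : (0 < #|[pred i | birth i == a.+1]|)%N by rewrite bc//; exact: block_size_gt0.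
  by move=> /card_gt0P[i /eqP ia]; exists i.
pose rep x := r x.-1.
have repP a : (a < size J)%N -> birth (rep a.+1) = a.+1 by exact: rP.
have [i0 i0P] : exists i0, i0 != rep (birth i0).
  have [e1|] := eqVneq i1 (rep (birth i1)); last by exists i1.
  by exists i2; rewrite b2 -b1 -e1 eq_sym.
have [V [aV iV LE]] := simplex_of_basis G bJ Hk repP i0P.
by exists d, V; split=> //; exists birth, g; split.
Qed.

(** The sum of the root generators is the least positive element, which gives
the Gorenstein property; the generator at the birth of a coordinate is fractional
there, so that the simplex is not a pyramid. *)
Lemma realizes_good k v d (V : 'I_d.+1 -> 'rV[R]_d) M J : (0 < k)%N -> (0 < v)%N ->
  affinely_independent V -> (forall i, int_row (V i)) ->
  filtration_data M J -> nth 0%N M (size J) = v -> realizes k M J (Lam V) ->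
  nonpyramidal_gorenstein_simplices R (\sum_(j < v) 'X^(j * k))
    (Body (conv_hull (range V))).
Proof.
move=> k0 v0 aV iV MJ Mv RV; have hts := realizes_heights k0 MJ RV.
case: RV => birth [g [G bs Hk LE]]; have [b0 _] := G.
have bE i : birth i = (birth i).-1.+1 by rewrite prednK.
have blt i : ((birth i).-1 < size J)%N by rewrite -bE.
split=> /=.
- by split; [exact: lattice_polytope_hull|exists V].
- apply: (gorenstein_of_min aV iV (u := root_sum J g (size J))).
  + apply/LE; apply: big_ind => [||b _]; [exact: span0|exact: span_add|].
    exact: span_gen.
  + move=> i; rewrite -/(size J).
    by have [] := root_sum_le MJ G (blt i) (leqnn _) (bE i).
  + move=> c /LE cs cb i; have [e de ->] := span_box MJ G (leqnn _) cs cb.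
    by have := digit_sum_le MJ G i (leqnn _) de; rewrite bs.
- move=> /(pyramid_int_coord aV iV)[i0 ci]; have gJ := blt i0.
  have gi := ci _ ((LE _).2 (span_gen g gJ)).
  have gb := gen_birth MJ G gJ (bE i0).
  have gbx := gen_box MJ G gJ.
  have : g (birth i0).-1.+1 0 i0 = 0.
    by apply: int_lt1; rewrite ?subr0 ?lexx ?ltr01.
  by move=> E; move: gb; rewrite E mulr0 => /eqP; rewrite eq_sym oner_eq0.
- by apply/(hstar_heights aV iV k0 v0); rewrite -Mv.
Qed.

(** A coordinate that is integral on the whole group would make a pyramid,
except in dimension 0, where the box has no room for an element of height k. *)
Lemma good_realizes k v (B : body R) : (0 < k)%N -> (2 <= v)%N ->
  nonpyramidal_gorenstein_simplices R (\sum_(j < v) 'X^(j * k)) B ->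
  exists d (V : 'I_d.+1 -> 'rV[R]_d) M J, [/\ B = Body (conv_hull (range V)),
    affinely_independent V /\ (forall i, int_row (V i)),
    filtration_data M J, nth 0%N M (size J) = v & realizes k M J (Lam V)].
Proof.
move=> k0 v2; have v0 : (0 < v)%N by exact: ltnW.
case: B => d P [/= [[_ PZ] [V [aV PE]]] _ np hs]; subst P.
have iV i : int_row (V i) by apply/ZlatticeP/PZ/affine_vertex.
have hts := (hstar_heights aV iV k0 v0).1 hs.
have nz i : exists2 c, Lam V c & c 0 i \isn't a Num.int.
  apply: contrapT => nc; apply: np.
  have ci c : Lam V c -> c 0 i \is a Num.int.
    by move=> Lc; apply/negPn/negP => ni; apply: nc; exists c.
  case: d V aV PZ hs iV hts i nc ci => [|e] V aV PZ hs iV hts i nc ci; last first.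
    exact: int_coord_pyramid ci.
  have [_ /(_ 1%N v2)[c [Lc cb cE]] _] := hts.
  move: cE; rewrite big_ord_recl big_ord0 addr0 mul1n => cE.
  have /andP[_] := cb ord0; rewrite cE ltrn1; lia.
have [M [J [MJ Mv RV]]] := heights_realizes k0 v0 (@LamB R d V) (LamZ iV)
  (Lam_torsion aV iV) hts nz.
by exists d, V, M, J.
Qed.

Lemma realizes_equiv k d (V V' : 'I_d.+1 -> 'rV[R]_d) M J :
  affinely_independent V -> affinely_independent V' ->
  unimod_equiv (conv_hull (range V)) (conv_hull (range V')) ->
  realizes k M J (Lam V) -> realizes k M J (Lam V').
Proof.
move=> aV aV' [U [w [uU E]]]; rewrite hull_unimod in E.
have aW := affine_unimod (w := w) uU aV.
have [s sE] := hull_inj aW aV' (esym E).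
have LL c : Lam V' (col_perm s c) <-> Lam V c.
  apply: (iff_trans (Lam_perm c sE)); apply: iff_sym.
  by apply: (Lam_unimod (w := w) c uU) => i.
exact: realizes_perm LL.
Qed.

Lemma realizes_same_equiv k d d' (V : 'I_d.+1 -> 'rV[R]_d)
    (V' : 'I_d'.+1 -> 'rV[R]_d') M J :
  affinely_independent V -> affinely_independent V' -> filtration_data M J ->
  realizes k M J (Lam V) -> realizes k M J (Lam V') ->
  body_equiv (Body (conv_hull (range V))) (Body (conv_hull (range V'))).
Proof.
move=> aV aV' MJ RV RV'; have [dd] := realizes_dim RV RV'; subst d'.
have [p pE] := realizes_same MJ RV RV'.
pose W i := V (p i).
have WL c : Lam W c <-> Lam V' c.
  have -> : c = col_perm p (col_perm (p^-1)%g c).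
    by rewrite -col_permM mulgV col_perm1.
  by rewrite pE; apply: Lam_perm.
have rW : range W = range V.
  apply/seteqP; split=> [_ [i _ <-]|_ [i _ <-]]; first by exists (p i).
  by exists ((p^-1)%g i) => //; rewrite /W permKV.
have aW : affinely_independent W.
  move=> a a1 a2 i; rewrite -[i](permK p).
  have sp (F : 'I_d.+1 -> R) : \sum_i F ((p^-1)%g i) = \sum_i F i.
    by rewrite [RHS](reindex_inj (@perm_inj _ (p^-1)%g)).
  apply: (aV (fun i => a ((p^-1)%g i))); first by rewrite sp.
  rewrite (reindex_inj (@perm_inj _ p)) -[RHS]a2.
  by apply: eq_bigr => j _; rewrite permK.
have [U [w [uU E]]] := Lam_eq_unimod aW aV' WL.
apply/body_equivE; exists U, w; split=> //.
rewrite -rW hull_unimod.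
by have -> : V' = (fun i => W i *m map_mx intr U + intvec R w) by exact: funext.
Qed.

End Assembly.

Theorem theorem1p1 (R : realType) (k v : nat) (hk : (1 <= k)%N)
    (hv : (2 <= v)%N) :
  exists Phi : set (body R) -> seq nat * seq {fset nat},
    set_bij
      [set unimod_class B | B in
         nonpyramidal_gorenstein_simplices R (\sum_(j < v) 'X^(j * k))]
      (chain_data v) Phi.
Proof.
(* The data of a class is the one realized by the group of a simplex in it. *)
pose reads X (D : seq nat * seq {fset nat}) := exists d (V : 'I_d.+1 -> 'rV[R]_d),
  [/\ affinely_independent V, X = unimod_class (Body (conv_hull (range V))),
      chain_data v D & realizes k D.1 D.2 (Lam V)].
have v0 : (0 < v)%N by exact: ltnW.
have reads_inj X X' D : reads X D -> reads X' D -> X = X'.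
  move=> [d [V [aV -> Dv RV]]] [d' [V' [aV' -> _ RV']]].
  apply/unimod_class_eq; case: D Dv RV RV' => M J /(chain_dataP _ _ hv)[MJ _].
  exact: realizes_same_equiv.
have reads_fun X D D' : reads X D -> reads X D' -> D = D'.
  move=> [d [V [aV -> Dv RV]]] [d' [V' [aV' /unimod_class_eq E Dv' RV']]].
  have /= dd := body_equiv_dim E; subst d'; move/body_equivE : E => E.
  have RV2 := realizes_equiv aV aV' E RV.
  case: D D' Dv Dv' RV RV' RV2 => M J [M' J'] /(chain_dataP _ _ hv)[MJ Mv].
  move=> /(chain_dataP _ _ hv)[MJ' Mv'] _ RV' RV2.
  by have [|-> ->] := realizes_unique hk MJ MJ' _ RV2 RV'; rewrite ?Mv ?Mv'.
have reads_ex B : nonpyramidal_gorenstein_simplices R (\sum_(j < v) 'X^(j * k)) B ->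
    exists D, reads (unimod_class B) D.
  move=> /(good_realizes hk hv)[d [V [M [J [-> [aV iV] MJ Mv RV]]]]].
  by exists (M, J), d, V; split=> //; apply/chain_dataP.
pose Phi X := xget ([::], [::]) [set D | reads X D].
have PhiP B : nonpyramidal_gorenstein_simplices R (\sum_(j < v) 'X^(j * k)) B ->
    reads (unimod_class B) (Phi (unimod_class B)).
  move=> /reads_ex[D hD].
  by apply: (xgetPex _ (P := [set D | reads (unimod_class B) D])); exists D.
exists Phi; split.
- by move=> _ [B gB <-]; have [d [V []]] := PhiP B gB.
- move=> _ _ /set_mem[B gB <-] /set_mem[C gC <-] E.
  by apply: reads_inj (PhiP B gB) _; rewrite E; exact: PhiP.
- move=> [M J] /[dup] Dv /(chain_dataP _ _ hv)[MJ Mv].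
  have J0 : (0 < size J)%N.
    by case: MJ => _ M0 _ _; case: (size J) Mv => //; rewrite M0; lia.
  have [d [V [aV iV RV]]] := data_simplex R hk J0 MJ.
  have gV := realizes_good hk v0 aV iV MJ Mv RV.
  exists (unimod_class (Body (conv_hull (range V)))).
    by exists (Body (conv_hull (range V))).
  by apply: reads_fun (PhiP _ gV) _; exists d, V.
Qed.
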